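(* Let $d\ge 0$, $I_1,I_2,I_3>0$, $a_k=(I_k+d)^{-1}$, $\mathbf A=\mathrm{diag}(a_1,a_2,a_3)$, and for $\gamma\in\mathbb R^3$ put $\mathrm g=\bigl(1-d(\gamma,\mathbf A\gamma)\bigr)^{-1/2}$ and $\mathbf A_\gamma=\mathbf A+d\,\mathrm g^2\,\mathbf A\gamma\otimes\gamma\mathbf A$. On the level set $(\gamma,\gamma)=1$, $(\gamma,M)=0$ in $\mathbb R^6\ni(\gamma,M)$ define $(\tilde\gamma,\tilde M)$ by $$\tilde\gamma_i^2=\frac{1}{(a_id-1)\,\tilde{\mathrm g}^2}\left(\gamma_i^2-\frac{(\gamma_1^2+\gamma_2^2+\gamma_3^2)(M_j^2+M_k^2)}{M_1^2+M_2^2+M_3^2}\right),\qquad \{i,j,k\}=\{1,2,3\},$$ $$\tilde M_1=\frac{\mathrm g}{\tilde{\mathrm g}}\left(-\frac{(\tilde\gamma_2^2+\tilde\gamma_3^2)\gamma_2\gamma_3M_1}{\tilde\gamma_2\tilde\gamma_3}+\frac{\gamma_1\tilde\gamma_2\gamma_3M_2}{\tilde\gamma_3}+\frac{\gamma_1\gamma_2\tilde\gamma_3M_3}{\tilde\gamma_2}\right),$$ $$\tilde M_2=\frac{\mathrm g}{\tilde{\mathrm g}}\left(\frac{\tilde\gamma_1\gamma_2\gamma_3M_1}{\tilde\gamma_3}-\frac{(\tilde\gamma_1^2+\tilde\gamma_3^2)\gamma_1\gamma_3M_2}{\tilde\gamma_1\tilde\gamma_3}+\frac{\gamma_1\gamma_2\tilde\gamma_3M_3}{\tilde\gamma_1}\right),$$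 $$\tilde M_3=\frac{\mathrm g}{\tilde{\mathrm g}}\left(\frac{\tilde\gamma_1\gamma_2\gamma_3M_1}{\tilde\gamma_2}+\frac{\gamma_1\tilde\gamma_2\gamma_3M_2}{\tilde\gamma_1}-\frac{(\tilde\gamma_1^2+\tilde\gamma_2^2)\gamma_1\gamma_2M_3}{\tilde\gamma_1\tilde\gamma_2}\right),$$ where $\tilde{\mathrm g}=\bigl(1-d(\tilde\gamma,\mathbf A\tilde\gamma)\bigr)^{-1/2}$, which is given explicitly by $$\tilde{\mathrm g}^2=\frac{1}{\mathrm g^2}\cdot\frac{dH_1-H_2}{(a_1d-1)(a_2d-1)(a_3d-1)H_2},\qquad H_1=(\mathbf A_\gamma M,M),\quad H_2=(M,M).$$ Then the transformation $(\gamma,M)\mapsto(\tilde\gamma,\tilde M)$ preserves the form of the Poisson bracket $$\{M_i,M_j\}=\varepsilon_{ijk}\bigl(\mathrm g^{-1}M_k-d\,\mathrm g\,(M,\mathbf A\gamma)\gamma_k\bigr),\quad \{M_i,\gamma_j\}=\varepsilon_{ijk}\mathrm g^{-1}\gamma_k,\quad \{\gamma_i,\gamma_j\}=0$$ (equivalently, of the corresponding Poisson bivector), i.e. the functions $\tilde\gamma_i,\tilde M_i$ satisfy the same relations with $\gamma,M,\mathrm g$ replaced by $\tilde\gamma,\tilde M,\tilde{\mathrm g}$; and it preserves the form of the integrals of motion: $$(\gamma,\gamma)=(\tilde\gamma,\tilde\gamma),\quad (\gamma,M)=(\tilde\gamma,\tilde M)=0,\quad (\mathbf A_\gamma M,M)=(\mathbf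 A_{\tilde\gamma}\tilde M,\tilde M),\quad (M,M)=(\tilde M,\tilde M).$$
   Context: $(\cdot,\cdot)$ is the Euclidean scalar product on $\mathbb R^3$, $\varepsilon_{ijk}$ is the totally skew-symmetric tensor (summation over $k$ understood), and $\mathbf A\gamma\otimes\gamma\mathbf A$ is the matrix with entries $a_i\gamma_i\gamma_ja_j$. The functions $(\gamma,\gamma)$ and $(\gamma,M)$ are Casimir functions of the bracket, so the bracket restricts to the level set $(\gamma,\gamma)=1$, $(\gamma,M)=0$; $H_1,H_2$ are the integrals of the Chaplygin ball. The transformation is considered on the open subset where $M\neq0$ and all $\tilde\gamma_i\ne0$, with a continuous choice of the signs of the square roots defining $\tilde\gamma_1,\tilde\gamma_2,\tilde\gamma_3$. *)

(* Defs.v *)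
From HB Require Import structures.
From mathcomp Require Import all_boot all_order all_algebra.
From mathcomp Require Import all_classical all_reals all_analysis.
From mathcomp Require Import ring lra.

Set Implicit Arguments.
Unset Strict Implicit.
Unset Printing Implicit Defensive.

Import Order.TTheory GRing.Theory Num.Theory.
Import numFieldNormedType.Exports.

Local Open Scope classical_set_scope.
Local Open Scope ring_scope.

(* Vectors of R^3 are row vectors, with coordinates [u 0 i]; the indices 1, 2, 3
   are the elements of 'I_3 = Z/3Z. A point of R^6 is a pair (gamma, M). *)
Notation vec R := 'rV[R]_3.
Notation phase R := ('rV[R]_3 * 'rV[R]_3)%type.

Definition dot (R : realType) (u v : vec R) : R := (u *m v^T) 0 0.

(* Even permutations of (1,2,3) are the triples (i, i+1, i+2) mod 3. *)
Definition levi_civita (R : realType) (i j k : 'I_3) : R :=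
  ((j == i + 1) && (k == i + 2%:R))%:R - ((j == i + 2%:R) && (k == i + 1))%:R.

Section ChaplyginBall.
Variables (R : realType) (d : R) (I : 'I_3 -> R).

Definition acoef (k : 'I_3) : R := (I k + d)^-1.

Definition matA : 'M[R]_3 := diag_mx (\row_k acoef k).

(* A is symmetric, so the row vector [gamma *m matA] is A gamma. *)
Definition gfun (gamma : vec R) : R :=
  (Num.sqrt (1 - d * dot gamma (gamma *m matA)))^-1.

Definition matAg (gamma : vec R) : 'M[R]_3 :=
  matA + (d * gfun gamma ^+ 2) *: ((gamma *m matA)^T *m (gamma *m matA)).

Definition H1 (gamma M : vec R) : R := dot (M *m matAg gamma) M.

Definition H2 (M : vec R) : R := dot M M.

Definition level_set : set (phase R) :=
  [set p | dot p.1 p.1 = 1 /\ dot p.1 p.2 = 0].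

Definition brMM (gamma M : vec R) (i j : 'I_3) : R :=
  \sum_k levi_civita R i j k *
    ((gfun gamma)^-1 * M 0 k
     - d * gfun gamma * dot M (gamma *m matA) * gamma 0 k).

Definition brMg (gamma : vec R) (i j : 'I_3) : R :=
  \sum_k levi_civita R i j k * (gfun gamma)^-1 * gamma 0 k.

Definition partial_gamma (F : phase R -> R) (p : phase R) (i : 'I_3) : R :=
  'D_((delta_mx 0 i, 0) : phase R) F p.

Definition partial_M (F : phase R -> R) (p : phase R) (i : 'I_3) : R :=
  'D_((0, delta_mx 0 i) : phase R) F p.

(* The bracket on R^6: the biderivation with values [brMM], [brMg] and
   {gamma_i, gamma_j} = 0 on the coordinate functions. *)
Definition bracket (F G : phase R -> R) (p : phase R) : R :=
  \sum_i \sum_j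
    (partial_M F p i * partial_M G p j * brMM p.1 p.2 i j
     + (partial_M F p i * partial_gamma G p j
        - partial_gamma F p j * partial_M G p i) * brMg p.1 i j).

Definition local_extension (f F : phase R -> R) (p : phase R) : Prop :=
  differentiable F p /\ \forall q \near p, level_set q -> F q = f q.

(* {f, h}(p) = v for the bracket restricted to the level set. Only the values of
   f and h on the level set near p matter: v is the bracket of differentiable
   extensions of f and h to R^6, which are required to exist, and v may not
   depend on their choice. *)
Definition level_bracket (f h : phase R -> R) (p : phase R) (v : R) : Prop :=
  [/\ exists F, local_extension f F p,
      exists G, local_extension h G p &
      forall F G, local_extension f F p -> local_extension h G p ->
        bracket F G p = v].

(* The equations for tilde gamma are implicit, as tilde g on the right is
   [gfun tg]. If [gfun tg] had a non-positive radicand it would be 0 here, whence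
   tg = 0, whose radicand is 1; so every solution has a genuine tilde g. *)
Definition is_tgamma (gamma M tg : vec R) : Prop :=
  forall i j k : 'I_3, uniq [:: i; j; k] ->
    tg 0 i ^+ 2 =
      1 / ((acoef i * d - 1) * gfun tg ^+ 2) *
      (gamma 0 i ^+ 2
       - (gamma 0 0 ^+ 2 + gamma 0 1 ^+ 2 + gamma 0 2%:R ^+ 2)
         * (M 0 j ^+ 2 + M 0 k ^+ 2)
         / (M 0 0 ^+ 2 + M 0 1 ^+ 2 + M 0 2%:R ^+ 2)).

(* The three formulas for tilde M differ by a permutation of the indices. *)
Definition is_tM (gamma M tg tM : vec R) : Prop :=
  forall i j k : 'I_3, uniq [:: i; j; k] ->
    tM 0 i =
      gfun gamma / gfun tg *
      (- ((tg 0 j ^+ 2 + tg 0 k ^+ 2) * gamma 0 j * gamma 0 k * M 0 i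
          / (tg 0 j * tg 0 k))
       + gamma 0 i * tg 0 j * gamma 0 k * M 0 j / tg 0 k
       + gamma 0 i * gamma 0 j * tg 0 k * M 0 k / tg 0 j).

Definition transformation_domain (tgamma : phase R -> vec R) : set (phase R) :=
  [set p | [/\ level_set p, p.2 != 0 & forall i, tgamma p 0 i != 0]].

End ChaplyginBall.

Lemma dotE (R : realType) (u v : vec R) :
  dot u v = u 0 0 * v 0 0 + u 0 1 * v 0 1 + u 0 2%:R * v 0 2%:R.
Proof.
rewrite /dot mxE !big_ord_recr big_ord0 /= add0r !mxE.
by congr (_ + _ + _); congr (u _ _ * v _ _); apply: val_inj.
Qed.

Lemma ord3 (P : 'I_3 -> Prop) : P 0 -> P 1 -> P 2%:R -> forall i, P i.
Proof.
move=> P0 P1 P2 [[|[|[|//]]] hi].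
- by rewrite (_ : Ordinal hi = 0) //; apply: val_inj.
- by rewrite (_ : Ordinal hi = 1) //; apply: val_inj.
- by rewrite (_ : Ordinal hi = 2%:R) //; apply: val_inj.
Qed.

(* The equations for tilde gamma are solvable on the whole level
   set minus M = 0, e.g. by the nonnegative roots. *)
Lemma tgamma_exists (R : realType) (d : R) (I : 'I_3 -> R) (gamma M : vec R) :
  0 <= d -> (forall k, 0 < I k) -> level_set (gamma, M) -> M != 0 ->
  exists tg, is_tgamma d I gamma M tg /\ forall i, 0 <= tg 0 i.
Proof.
move=> d0 I0 [/=]; rewrite !dotE => gg gM M0.
have gg' : gamma 0 0 ^+ 2 + gamma 0 1 ^+ 2 + gamma 0 2%:R ^+ 2 = 1.
  by rewrite !expr2.
pose m2 := M 0 0 ^+ 2 + M 0 1 ^+ 2 + M 0 2%:R ^+ 2.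
have m2p : 0 < m2.
  rewrite lt_neqAle !addr_ge0 ?sqr_ge0 // andbT eq_sym.
  apply: contraNneq M0 => /eqP; rewrite /m2 !paddr_eq0 ?addr_ge0 ?sqr_ge0 //.
  rewrite !sqrf_eq0 => /andP[/andP[/eqP h0 /eqP h1] /eqP h2].
  by apply/eqP/matrixP => i; rewrite (ord1 i); apply: ord3; rewrite mxE.
pose n2 i := 1 - gamma 0 i ^+ 2 - M 0 i ^+ 2 / m2.
have m2n : m2 != 0 by rewrite gt_eqF.
have n2E i x : forall N D, N = 1 -> D = 0 -> x ^+ 2 = m2 * N - gamma 0 i ^+ 2 * m2 - M 0 i ^+ 2 * N
    - D ^+ 2 + 2%:R * D * gamma 0 i * M 0 i -> 0 <= n2 i.
  move=> ? ? -> -> xE; suff -> : n2 i = x ^+ 2 / m2 by rewrite divr_ge0 ?sqr_ge0 // ltW.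
  by rewrite xE /n2; field.
have n2p : forall i, 0 <= n2 i.
  apply: ord3.
  - apply: (n2E 0 (M 0 1 * gamma 0 2%:R - M 0 2%:R * gamma 0 1) _ _ gg gM).
    by rewrite /m2; ring.
  - apply: (n2E 1 (M 0 0 * gamma 0 2%:R - M 0 2%:R * gamma 0 0) _ _ gg gM).
    by rewrite /m2; ring.
  - apply: (n2E 2%:R (M 0 0 * gamma 0 1 - M 0 1 * gamma 0 0) _ _ gg gM).
    by rewrite /m2; ring.
have sumn : n2 0 + n2 1 + n2 2%:R = 1.
  have -> : n2 0 + n2 1 + n2 2%:R = 3%:R - (gamma 0 0 ^+ 2 + gamma 0 1 ^+ 2 + gamma 0 2%:R ^+ 2) - m2 / m2.
    by rewrite /n2 /m2; ring.
  by rewrite gg' divff //; ring.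
pose b i := 1 - acoef d I i * d.
have bp i : 0 < b i.
  rewrite /b /acoef subr_gt0 mulrC ltr_pdivrMr ?mul1r ?ltrDr //.
  by rewrite ltr_wpDr.
pose G := n2 0 / b 0 + n2 1 / b 1 + n2 2%:R / b 2%:R.
have bge i : n2 i <= n2 i / b i.
  rewrite ler_pdivlMr // ler_piMr // /b gerBl mulr_ge0 // /acoef invr_ge0.
  by rewrite addr_ge0 // ltW.
have Gp : 0 < G.
  have : 1 <= G by rewrite -sumn /G !lerD.
  exact: lt_le_trans.
have t2p i : 0 <= n2 i / b i / G by rewrite !divr_ge0 // ltW.
exists (\row_i Num.sqrt (n2 i / b i / G)); split; last first.
  by move=> i; rewrite mxE sqrtr_ge0.
have gE : gfun d I (\row_i Num.sqrt (n2 i / b i / G)) ^+ 2 = G.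
  have rE : 1 - d * dot (\row_i Num.sqrt (n2 i / b i / G))
      (\row_i Num.sqrt (n2 i / b i / G) *m matA d I) = G^-1.
    rewrite dotE /matA !mul_mx_diag !mxE.
    have sq i : Num.sqrt (n2 i / b i / G) * (Num.sqrt (n2 i / b i / G) * acoef d I i)
      = n2 i / b i / G * acoef d I i.
      by rewrite mulrA -expr2 sqr_sqrtr.
    rewrite !sq.
    have e i : d * (n2 i / b i / G * acoef d I i) = (n2 i / b i - n2 i) / G.
      have -> : d * (n2 i / b i / G * acoef d I i)
        = n2 i / b i * (acoef d I i * d) / G by ring.
      have -> : acoef d I i * d = 1 - b i by rewrite /b; ring.
      by rewrite mulrBr mulr1 divfK // gt_eqF.
    rewrite !mulrDr !e -!mulrDl.
    have -> : n2 0 / b 0 - n2 0 + (n2 1 / b 1 - n2 1)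
      + (n2 2%:R / b 2%:R - n2 2%:R) = G - 1 by rewrite -sumn /G; ring.
    by rewrite mulrBl divff ?gt_eqF //; ring.
  by rewrite /gfun exprVn rE sqr_sqrtr ?invrK // invr_ge0 ltW.
move=> i j k uijk; rewrite gE gg' -/m2 mul1r mxE sqr_sqrtr //.
have -> : M 0 j ^+ 2 + M 0 k ^+ 2 = m2 - M 0 i ^+ 2.
  move: i j k uijk; rewrite /m2.
  by do 3 apply: ord3 => //=; move=> _; ring.
have bi := bp i; rewrite /n2.
have -> : acoef d I i * d - 1 = - b i by rewrite /b; ring.
field; rewrite ?gt_eqF //.
Qed.

(* Main.v *)
(** Write [n = gamma x M / |M|], [b_k = 1 - d a_k], [beta_k = sqrt b_k].
    On the level set the equations for [tilde gamma] say that, up to signs,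
    [tilde gamma] is the normalization [v] of [n / beta] (entrywise), and those
    for [tilde M] say that [tilde g * tilde M] is, up to the matching signs,
    [Lambda = c x (beta gamma)], where [c = p / beta] and [p = gamma x (g M)].

    The vectors [gamma] and [g M] satisfy the Lie-Poisson relations of e(3) on
    [(gamma, M) = 0], so [gamma] and [p] satisfy those of the Dirac bracket on
    the cotangent bundle of the unit sphere. The map [p -> v] is the quarter
    turn of the geodesic flow followed by the point transformation
    [n -> (n / beta) / |n / beta|]; [Lambda] is the lifted momentum, so
    [v, Lambda] satisfy the e(3) relations again. Changing signs by a diagonal
    orthogonal matrix preserves them (the momentum being a pseudovector), and
    the converse of the first step returns to the Chaplygin bracket.

    The integrals follow from the identity
    [d H1 - H2 = - g^2 b_1 b_2 b_3 \sum_l (gamma x M)_l^2 / b_l]. *)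

Require Import Defs.
From HB Require Import structures.
From mathcomp Require Import all_boot all_order all_algebra.
From mathcomp Require Import all_classical all_reals all_analysis.
From mathcomp Require Import ring lra.

Set Implicit Arguments.
Unset Strict Implicit.
Unset Printing Implicit Defensive.

Import Order.TTheory GRing.Theory Num.Theory.
Import numFieldNormedType.Exports.

Local Open Scope classical_set_scope.
Local Open Scope ring_scope.

(** * Cyclic triples of indices *)

Definition cyc (i j k : 'I_3) : Prop := j = i + 1 /\ k = i + 2%:R.

Lemma cycS i j k : cyc i j k -> cyc j k i.
Proof.
by case=> -> ->; split; move: i; apply: ord3; apply/eqP.
Qed.

Lemma cyc_neq i j k : cyc i j k -> (i == j = false) * (j == i = false).
Proof. by case=> -> _; split; move: i; apply: ord3; apply/eqP. Qed.

Lemma cyc_uniq i j k : cyc i j k -> uniq [:: i; j; k].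
Proof. by case=> -> ->; move: i; apply: ord3. Qed.

Lemma cyc_ex i j : j <> i -> exists k, cyc i j k \/ cyc j i k.
Proof.
move: i j; apply: ord3; apply: ord3 => // _;
  first [by exists 0; left; split; apply/eqP
    | by exists 1; left; split; apply/eqP
    | by exists 2%:R; left; split; apply/eqP
    | by exists 0; right; split; apply/eqP
    | by exists 1; right; split; apply/eqP
    | by exists 2%:R; right; split; apply/eqP].
Qed.

Lemma sum_cyc (V : nmodType) (f : 'I_3 -> V) i j k : cyc i j k ->
  \sum_l f l = f i + f j + f k.
Proof.
case=> -> ->; rewrite (bigD1 i) // (bigD1 (i + 1)) /=; last first.
  by move: i; apply: ord3.
rewrite (bigD1 (i + 2%:R)) /=; last by move: i; apply: ord3.
rewrite big1 ?addr0 ?addrA // => l; move: i l.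
by apply: ord3; apply: ord3.
Qed.

(** * Poisson relations for an abstract skew form on covectors *)

Section PoissonRelations.
Variables (R : realFieldType) (V : lmodType R) (br : V -> V -> R).
Hypothesis br_linear : forall a u v w, br (a *: u + v) w = a * br u w + br v w.
Hypothesis brC : forall u v, br u v = - br v u.

Lemma brDl u v w : br (u + v) w = br u w + br v w.
Proof. by rewrite -[u]scale1r br_linear mul1r scale1r. Qed.

Lemma br0l w : br 0 w = 0.
Proof. by have := brDl 0 0 w; rewrite addr0 => h; lra. Qed.

Lemma brZl a u w : br (a *: u) w = a * br u w.
Proof. by rewrite -[a *: u]addr0 br_linear br0l addr0. Qed.

Lemma brNl u w : br (- u) w = - br u w.
Proof. by rewrite -scaleN1r brZl mulN1r. Qed.

Lemma brDr u v w : br w (u + v) = br w u + br w v.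
Proof. by rewrite brC brDl opprD -!brC. Qed.

Lemma brZr a u w : br w (a *: u) = a * br w u.
Proof. by rewrite brC brZl -mulrN -brC. Qed.

Lemma brNr u w : br w (- u) = - br w u.
Proof. by rewrite brC brNl -brC. Qed.

Lemma brv u : br u u = 0.
Proof. by have := brC u u; lra. Qed.

Definition brE := (brDl, brDr, brZl, brZr, brNl, brNr, brv).

(* [br] is a bracket of covectors, [dx i] and [dm i] are the differentials of
   functions with values [x i] and [m i], and [K k] is the value of
   {m_i, m_j}. *)
Definition lie_rel (x K : 'I_3 -> R) (c : R) (dx dm : 'I_3 -> V) : Prop :=
  forall i j k, cyc i j k ->
  [/\ br (dx i) (dx j) = 0, br (dm i) (dx i) = 0,
      br (dm i) (dx j) = c * x k, br (dm j) (dx i) = - (c * x k) &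
      br (dm i) (dm j) = K k].

(** A product of equations serves as one multi-rule for [rewrite]: together with [brv], the three
    rotations in [lie_relP] evaluate every bracket of two of the six covectors, in either order. *)
Definition lie_table (x K : 'I_3 -> R) (c : R) (dx dm : 'I_3 -> V) i j k :=
  (((br (dx i) (dx j) = 0) * (br (dx j) (dx i) = 0)) *
   ((br (dm i) (dx i) = 0) * (br (dx i) (dm i) = 0)) *
   ((br (dm i) (dx j) = (c * x k)%R) * (br (dx j) (dm i) = - (c * x k)%R)) *
   ((br (dm j) (dx i) = - (c * x k)%R) * (br (dx i) (dm j) = (c * x k)%R)) *
   ((br (dm i) (dm j) = K k) * (br (dm j) (dm i) = - K k)))%type.

Lemma lie_relP x K c dx dm i j k : lie_rel x K c dx dm -> cyc i j k ->
  lie_table x K c dx dm i j k * lie_table x K c dx dm j k i *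
  lie_table x K c dx dm k i j.
Proof.
move=> h; have H i' j' k' : cyc i' j' k' -> lie_table x K c dx dm i' j' k'.
  move=> /h [e1 e2 e3 e4 e5].
  by split; [split; [split; [split|]|]|]; split => //;
    rewrite brC ?(e1, e2, e3, e4, e5) ?oppr0 ?opprK.
by move=> cy; split; [split|]; apply: H;
    rewrite //; do ?[exact: cycS | exact: cycS (cycS cy)].
Qed.

(* [g M] generates rotations on the zero level of [(gamma, M)]. *)
Lemma lie_rel_momentum (d g : R) (a x m L : 'I_3 -> R) (dx dm dL : 'I_3 -> V) :
  g != 0 -> \sum_i x i * m i = 0 ->
  (forall i, L i = g * m i) ->
  (forall i, dL i = g *: dm i + (m i * (d * g ^+ 3)) *: \sum_l (a l * x l) *: dx l) ->
  lie_rel x (fun k => g^-1 * m k - d * g * (\sum_l a l * x l * m l) * x k) g^-1 dx dm ->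
  lie_rel x L 1 dx dL.
Proof.
move=> g0 xm LE dLE H i j k cy; have T := lie_relP H cy.
move: xm; rewrite (sum_cyc _ cy) => xm.
rewrite !dLE !(sum_cyc _ cy) !brE !T !(sum_cyc _ cy); split.
- by [].
- by ring.
- by field.
- by field.
- rewrite LE; apply: subr0_eq.
  (* The two sides differ by a multiple of [(x, m)], which vanishes. *)
  transitivity (- d * g ^+ 3 * a k * x k * (x i * m i + x j * m j + x k * m k));
    last by rewrite xm mulr0.
  by field.
Qed.


(* The Dirac bracket of R^3 x R^3 on the cotangent bundle of the unit sphere. *)
Definition dirac_rel (x p : 'I_3 -> R) (dx dp : 'I_3 -> V) : Prop :=
  forall i j,
  [/\ br (dx i) (dx j) = 0, br (dp i) (dx j) = (i == j)%:R - x i * x j &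
      br (dp i) (dp j) = x i * p j - x j * p i].

(** As [L] rotates [x], the bracket of [p_i] and [x_j] is [|x|^2 delta_ij - x_i x_j], the projection
    to the tangent plane when [|x| = 1]. On [(x, L) = 0] one also has [x * p = - L] for the cross
    product, which identifies the bracket of [p_i] and [p_j]. *)
Lemma dirac_rel_cross (x L p : 'I_3 -> R) (dx dL dp : 'I_3 -> V) :
  \sum_i x i * x i = 1 -> \sum_i x i * L i = 0 ->
  (forall i j k, cyc i j k -> p i = x j * L k - x k * L j) ->
  (forall i j k, cyc i j k ->
     dp i = (x j *: dL k + L k *: dx j) - (x k *: dL j + L j *: dx k)) ->
  lie_rel x L 1 dx dL -> dirac_rel x p dx dp.
Proof.
move=> xx xL pE dpE H.
have diag i j k : cyc i j k ->
  [/\ br (dx i) (dx i) = 0, br (dp i) (dx i) = 1 - x i * x i & br (dp i) (dp i) = 0].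
  move=> cy; have T := lie_relP H cy; move: xx; rewrite (sum_cyc _ cy) => xx.
  have -> : 1 - x i * x i = x j * x j + x k * x k by rewrite -xx; ring.
  by rewrite !(dpE _ _ _ cy) !brE !T; split => //; ring.
have offdiag i j k : cyc i j k ->
  [/\ br (dx i) (dx j) = 0, br (dp i) (dx j) = - (x i * x j),
      br (dp j) (dx i) = - (x i * x j) &
      br (dp i) (dp j) = x i * p j - x j * p i].
  move=> cy; have T := lie_relP H cy; have cy' := cycS cy.
  move: xx xL; rewrite !(sum_cyc _ cy) => xx xL.
  rewrite (dpE _ _ _ cy) (dpE _ _ _ cy') (pE _ _ _ cy) (pE _ _ _ cy').
  rewrite !brE !T; split; [by []|by ring|by ring|].
  apply: subr0_eq.
  by transitivity (- x k * (x i * L i + x j * L j + x k * L k)); [ring|rewrite xL mulr0].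
move=> i j; have [<-|/eqP/nesym/cyc_ex [k [cy|cy]]] := eqVneq i j.
- have [e1 e2 e3] := diag i _ _ (conj erefl erefl).
  by rewrite e1 e2 e3 subrr.
- have [e1 e2 e3 e4] := offdiag _ _ _ cy.
  by rewrite e1 e2 e4 sub0r.
- have [e1 e2 e3 e4] := offdiag _ _ _ cy.
  rewrite brC e1 e3 (brC (dp i)) e4 sub0r oppr0; split => //; ring.
Qed.

(** Put [c = p / b] and [h = b x] entrywise, so that [v] is [c] normalized and [Lam] is the cross
    product of [c] and [h]. The brackets of [c] and [h] are canonical up to terms with a factor
    [e_l = x_l / b_l]. These terms act through the infinitesimal scaling of [c] by a factor and of
    [h] by its inverse, under which [v] and [Lam] are invariant. Only the canonical part remains,
    and for it [Lam] is the angular momentum, which generates rotations. *)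
Lemma lie_rel_cotangent_lift (x p b v Lam : 'I_3 -> R) (r : R)
    (dx dp dv dLam : 'I_3 -> V) :
  (forall i, b i != 0) -> r != 0 ->
  r ^+ 2 * \sum_i ((b i)^-1 * p i) ^+ 2 = 1 ->
  (forall i, v i = r * ((b i)^-1 * p i)) ->
  (forall i, dv i = (r * (b i)^-1) *: dp i -
     (r ^+ 3 * ((b i)^-1 * p i)) *: \sum_l ((b l)^-1 ^+ 2 * p l) *: dp l) ->
  (forall i j k, cyc i j k -> Lam i = (b j)^-1 * b k * (p j * x k) - (b k)^-1 * b j * (p k * x j)) ->
  (forall i j k, cyc i j k ->
     dLam i = ((b j)^-1 * b k) *: (p j *: dx k + x k *: dp j)
              - ((b k)^-1 * b j) *: (p k *: dx j + x j *: dp k)) ->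
  dirac_rel x p dx dp -> lie_rel v Lam 1 dv dLam.
Proof.
move=> b0 r0 rE vE dvE LE dLE D i j k cy.
have cy1 := cycS cy; have cy2 := cycS cy1.
pose c l := (b l)^-1 * p l; pose h l := b l * x l; pose e l := (b l)^-1 * x l.
pose dc l := (b l)^-1 *: dp l; pose dh l := b l *: dx l.
have hh l n : br (dh l) (dh n) = 0.
  by have [E1 _ _] := D l n; rewrite !brE E1 !mulr0.
have ch l n : br (dc l) (dh n) = (l == n)%:R - e l * h n.
  have [_ E1 _] := D l n; rewrite !brE E1 /e /h.
  by case: eqVneq => [->|_]; rewrite /= ?mulr1n ?mulr0n; field; rewrite ?b0.
have hc l n : br (dh n) (dc l) = e l * h n - (l == n)%:R by rewrite brC ch opprB.
have cc l n : br (dc l) (dc n) = e l * c n - e n * c l.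
  by have [_ _ E1] := D l n; rewrite !brE E1 /e /c; ring.
have dvE' l : dv l = r *: dc l - (r ^+ 3 * c l) *: (c i *: dc i + c j *: dc j + c k *: dc k).
  rewrite dvE (sum_cyc _ cy) /dc !scalerA /c.
  by congr (_ - _ *: (_ *: _ + _ *: _ + _ *: _)); rewrite expr2; ring.
have dLE' l m n : cyc l m n ->
    dLam l = (c m *: dh n + h n *: dc m) - (c n *: dh m + h m *: dc n).
  move=> /dLE ->; rewrite !scalerDr !scalerA /c /h.
  by congr (_ *: _ + _ *: _ - (_ *: _ + _ *: _)); ring.
have LE' l m n : cyc l m n -> Lam l = c m * h n - c n * h m.
  by move=> /LE ->; rewrite /c /h; ring.
have rE' : r ^+ 2 * (c i ^+ 2 + c j ^+ 2 + c k ^+ 2) = 1.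
  by rewrite -rE (sum_cyc _ cy).
have nq := (cyc_neq cy, cyc_neq cy1, cyc_neq cy2, eqxx).
(* From here on only the brackets of [dc] and [dh] matter. The terms with [e] in [Lc] and [Lh] have
   opposite signs: this is the reciprocal scaling of [c] and [h]. *)
clearbody dc dh; have Lc l m n q : cyc l m n -> br (dLam l) (dc q) =
    (e m * h n - e n * h m) * c q + c m * - (n == q)%:R + c n * (m == q)%:R.
  by move=> /dLE' ->; rewrite !brE !cc !hc ![_ == q]eq_sym; ring.
have Lh l m n q : cyc l m n -> br (dLam l) (dh q) =
    - (e m * h n - e n * h m) * h q + h n * (m == q)%:R - h m * (n == q)%:R.
  by move=> /dLE' ->; rewrite !brE !ch !hh; ring.
split.
- rewrite !dvE' !brE !cc.
  apply: subr0_eq.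
  (* Here and in the next three cases the two sides differ by a multiple of [1 - r^2 |c|^2 = 0]. *)
  transitivity (r ^+ 2 * (e i * c j - e j * c i) * (1 - r ^+ 2 * (c i ^+ 2 + c j ^+ 2 + c k ^+ 2)));
    last by rewrite rE' subrr mulr0.
  by ring.
- rewrite dvE' !brE !(Lc _ _ _ _ cy) !nq /= ?mulr1n ?mulr0n.
  apply: subr0_eq.
  transitivity (r * (e j * h k - e k * h j) * c i * (1 - r ^+ 2 * (c i ^+ 2 + c j ^+ 2 + c k ^+ 2)));
    last by rewrite rE' subrr mulr0.
  by ring.
- rewrite dvE' !brE !(Lc _ _ _ _ cy) !nq /= ?mulr1n ?mulr0n vE -/(c k).
  apply: subr0_eq.
  transitivity (r * (e j * h k - e k * h j) * c j * (1 - r ^+ 2 * (c i ^+ 2 + c j ^+ 2 + c k ^+ 2)));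
    last by rewrite rE' subrr mulr0.
  by ring.
- rewrite dvE' !brE !(Lc _ _ _ _ cy1) !nq /= ?mulr1n ?mulr0n vE -/(c k).
  apply: subr0_eq.
  transitivity (r * (e k * h i - e i * h k) * c i * (1 - r ^+ 2 * (c i ^+ 2 + c j ^+ 2 + c k ^+ 2)));
    last by rewrite rE' subrr mulr0.
  by ring.
- rewrite (dLE' _ _ _ cy1) !brE !(Lc _ _ _ _ cy) !(Lh _ _ _ _ cy) !nq /= ?mulr1n ?mulr0n (LE' _ _ _ cy2).
  by ring.
Qed.

(** Each relation is multiplied by a product of signs that reduces to the expected one:
    [(s_j s_k) s_j = s_k] and [(s_j s_k) (s_k s_i) = s_i s_j]. *)
Lemma lie_rel_sign (x L s : 'I_3 -> R) (dx dL dx' dL' : 'I_3 -> V) :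
  (forall i, s i ^+ 2 = 1) ->
  (forall i, dx' i = s i *: dx i) ->
  (forall i j k, cyc i j k -> dL' i = (s j * s k) *: dL i) ->
  lie_rel x L 1 dx dL ->
  lie_rel (fun i => s i * x i) (fun i => s (i + 1) * s (i + 2%:R) * L i) 1 dx' dL'.
Proof.
move=> s2 dxE dLE H i j k cy.
have T := lie_relP H cy.
have [E1 E2] := cycS (cycS cy); rewrite -E1 -E2.
rewrite !dxE (dLE _ _ _ cy) (dLE _ _ _ (cycS cy)) !brE !T.
have s2k : s k * s k = 1 by rewrite -expr2.
have s2j : s j * s j = 1 by rewrite -expr2.
have s2i : s i * s i = 1 by rewrite -expr2.
split; [by ring|by ring| | | ].
- by rewrite -[RHS]mul1r -s2j; ring.
- by rewrite !mul1r -[RHS]mul1r -s2i; ring.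
- by rewrite -[RHS]mul1r -s2k; ring.
Qed.

(** The converse of [lie_rel_momentum], for [m = y / g]: the gradient of [1 / g] is [- d g A x], and
    the brackets of the [m_i] come out right modulo [(x, y)]. *)
Lemma lie_rel_rescale (d g : R) (a x y : 'I_3 -> R) (dx dy dm : 'I_3 -> V) :
  g != 0 -> \sum_i x i * y i = 0 ->
  (forall i, dm i = g^-1 *: dy i - (y i * (d * g)) *: \sum_l (a l * x l) *: dx l) ->
  lie_rel x y 1 dx dy ->
  lie_rel x (fun k => g^-1 * (g^-1 * y k)
      - d * g * (\sum_l a l * x l * (g^-1 * y l)) * x k) g^-1 dx dm.
Proof.
move=> g0 xy dmE H i j k cy; have T := lie_relP H cy.
move: xy; rewrite (sum_cyc _ cy) => xy.
rewrite !dmE !(sum_cyc _ cy) !brE !T; split.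
- by [].
- by ring.
- by ring.
- by ring.
- apply: subr0_eq.
  transitivity (d * a k * x k * (x i * y i + x j * y j + x k * y k));
    last by rewrite xy mulr0.
  by field.
Qed.
End PoissonRelations.

Lemma sum3E (V : nmodType) (f : 'I_3 -> V) : \sum_l f l = f 0 + f 1 + f 2%:R.
Proof. by apply: sum_cyc; split; apply/eqP. Qed.

(** * Gradients of functions on R^6 *)

Section Gradients.
Variable R : realType.
Implicit Types (F G : phase R -> R) (p w h : phase R).

(* Covectors of R^6 are identified with points of R^6. *)
Definition pairing w h : R := dot w.1 h.1 + dot w.2 h.2.

Definition is_grad F p w := is_diff p F (pairing w).

Lemma pairingD w w' h : pairing (w + w') h = pairing w h + pairing w' h.
Proof. by rewrite /pairing !dotE /= !mxE; ring. Qed.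

Lemma pairingZ (c : R) w h : pairing (c *: w) h = c * pairing w h.
Proof. by rewrite /pairing !dotE /= !mxE; ring. Qed.

Lemma is_grad_cst (c : R) p : is_grad (fun=> c) p 0.
Proof.
apply: is_diff_eq; apply/funext => h /=.
by rewrite -[0 in RHS](scale0r 0) pairingZ mul0r.
Qed.

Lemma is_gradD F G p w w' : is_grad F p w -> is_grad G p w' ->
  is_grad (fun q => F q + G q) p (w + w').
Proof.
move=> Fw Gw'; have := @is_diffD _ _ _ F G _ _ p Fw Gw'.
by move=> /is_diff_eq; apply; apply/funext => h; rewrite pairingD.
Qed.

Lemma is_gradM F G p w w' : is_grad F p w -> is_grad G p w' ->
  is_grad (fun q => F q * G q) p (F p *: w' + G p *: w).
Proof.
move=> Fw Gw'; have := @is_diffM _ _ F G _ _ p Fw Gw'.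
by move=> /is_diff_eq; apply; apply/funext => h; rewrite pairingD !pairingZ.
Qed.

Lemma is_gradZ (c : R) F p w : is_grad F p w -> is_grad (fun q => c * F q) p (c *: w).
Proof.
move=> Fw; have := is_gradM (is_grad_cst c p) Fw.
by rewrite scaler0 addr0.
Qed.

Lemma is_gradB F G p w w' : is_grad F p w -> is_grad G p w' ->
  is_grad (fun q => F q - G q) p (w - w').
Proof.
move=> Fw Gw'; have := is_gradD Fw (is_gradZ (-1) Gw').
rewrite scaleN1r; congr (is_grad _ _ _).
by apply/funext => q; rewrite mulN1r.
Qed.

Lemma is_grad_sum n (F : 'I_n -> phase R -> R) p (w : 'I_n -> phase R) :
  (forall i, is_grad (F i) p (w i)) -> is_grad (fun q => \sum_i F i q) p (\sum_i w i).
Proof.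
elim: n F w => [|n IH] F w FE.
  rewrite big_ord0; have -> : (fun q => \sum_(i < 0) F i q) = fun=> 0.
    by apply/funext => q; rewrite big_ord0.
  exact: is_grad_cst.
rewrite big_ord_recl; have -> : (fun q => \sum_(i < n.+1) F i q) =
   fun q => F ord0 q + \sum_(i < n) F (lift ord0 i) q.
  by apply/funext => q; rewrite big_ord_recl.
by apply: is_gradD => //; apply: IH.
Qed.

Lemma is_diff_scalar (W : normedModType R) (f : R -> W) (x : R) (l : W) :
  is_derive x 1 f l -> is_diff x f (fun t => t *: l).
Proof.
move=> [df fl]; apply: DiffDef; first exact/derivable1_diffP.
by rewrite deriv1E //; apply/funext => t; rewrite derive1E fl.
Qed.

Lemma is_grad_comp (f : R -> R) (l : R) F p w : is_derive (F p) 1 f l ->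
  is_grad F p w -> is_grad (fun q => f (F q)) p (l *: w).
Proof.
move=> /is_diff_scalar fl Fw; have := is_diff_comp Fw fl.
move=> /is_diff_eq; apply; apply/funext => h /=.
by rewrite pairingZ mulrC.
Qed.

Lemma is_derive_inv (x : R) : x != 0 -> is_derive x 1 (fun t : R => t^-1) (- x ^- 2).
Proof.
move=> x0; have d : derivable (@id R) x 1 by exact: derivable_id.
apply: DeriveDef; first exact: (derivableV (f := @id R)).
by rewrite (deriveV (f := @id R)) // derive_id [_ *: _]mulr1.
Qed.

Lemma is_derive_invsqrt (x : R) : 0 < x ->
  is_derive x 1 (fun t : R => (Num.sqrt t)^-1) (- ((Num.sqrt x)^-1 ^+ 3 / 2)).
Proof.
move=> x0; have s0 : Num.sqrt x != 0 by rewrite gt_eqF // sqrtr_gt0.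
have := is_derive1_comp (is_derive_inv s0) (is_derive1_sqrt x0).
move=> /is_derive_eq; apply; field.
by rewrite s0.
Qed.

Lemma is_grad_coord_gamma i p : is_grad (fun q => q.1 0 i) p (delta_mx 0 i, 0).
Proof.
have lin : linear (fun q : phase R => q.1 0 i) by move=> a u v /=; rewrite !mxE.
pose f : {linear phase R -> R} :=
  HB.pack (fun q : phase R => q.1 0 i) (GRing.isLinear.Build _ _ _ _ _ lin).
have fc : continuous f.
  move=> q; apply: (@continuous_comp _ _ _ fst (fun N : 'rV[R]_3 => N 0 i)).
    exact: cvg_fst.
  exact: coord_continuous.
apply: DiffDef; first exact: (linear_differentiable (f := f)).
rewrite (diff_lin (f := f)) //; apply/funext => h /=.
rewrite /pairing /= [X in _ + X](_ : _ = 0); last by rewrite dotE !mxE; ring.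
rewrite /dot mxE (bigD1 i) //= big1 ?addr0 => [|l li]; rewrite !mxE ?eqxx /=.
  by rewrite mul1r.
by rewrite (negbTE li) mul0r.
Qed.

Lemma is_grad_coord_M i p : is_grad (fun q => q.2 0 i) p (0, delta_mx 0 i).
Proof.
have lin : linear (fun q : phase R => q.2 0 i) by move=> a u v /=; rewrite !mxE.
pose f : {linear phase R -> R} :=
  HB.pack (fun q : phase R => q.2 0 i) (GRing.isLinear.Build _ _ _ _ _ lin).
have fc : continuous f.
  move=> q; apply: (@continuous_comp _ _ _ snd (fun N : 'rV[R]_3 => N 0 i)).
    exact: cvg_snd.
  exact: coord_continuous.
apply: DiffDef; first exact: (linear_differentiable (f := f)).
rewrite (diff_lin (f := f)) //; apply/funext => h /=.
rewrite /pairing /= [X in X + _](_ : _ = 0); last by rewrite dotE !mxE; ring.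
rewrite /dot mxE (bigD1 i) //= big1 ?addr0 => [|l li]; rewrite !mxE ?eqxx /=.
  by rewrite add0r mul1r.
by rewrite (negbTE li) mul0r.
Qed.

Lemma dot_delta (u : vec R) i : dot u (delta_mx 0 i) = u 0 i.
Proof.
rewrite /dot mxE (bigD1 i) //= big1 ?addr0 => [|l li]; rewrite !mxE ?eqxx /=.
  by rewrite mulr1.
by rewrite (negbTE li) mulr0.
Qed.

Lemma partial_gammaE F p w i : is_grad F p w -> partial_gamma F p i = w.1 0 i.
Proof.
move=> [dF Fw]; rewrite /partial_gamma deriveE // Fw /pairing /= dot_delta.
by rewrite [dot w.2 _]dotE !mxE; ring.
Qed.

Lemma partial_ME F p w i : is_grad F p w -> partial_M F p i = w.2 0 i.
Proof.
move=> [dF Fw]; rewrite /partial_M deriveE // Fw /pairing /= dot_delta.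
by rewrite [dot w.1 _]dotE !mxE; ring.
Qed.

Lemma differentiable_is_grad F p : differentiable F p -> exists w, is_grad F p w.
Proof.
move=> dF; exists (\row_i 'd F p (delta_mx 0 i, 0), \row_i 'd F p (0, delta_mx 0 i)).
apply: DiffDef => //; apply/funext => h.
have hE : h = \sum_i (h.1 0 i *: (delta_mx 0 i, 0) + h.2 0 i *: (0, delta_mx 0 i) : phase R).
  apply: injective_projections => /=.
    rewrite (raddf_sum fst) [LHS]row_sum_delta; apply: eq_bigr => i _ /=.
    by rewrite scaler0 addr0.
  rewrite (raddf_sum snd) [LHS]row_sum_delta; apply: eq_bigr => i _ /=.
  by rewrite scaler0 add0r.
rewrite {1}hE raddf_sum /= /pairing /dot !mxE -big_split; apply: eq_bigr => i _ /=.
by rewrite !mxE raddfD /= !linearZ_LR /=; congr (_ + _); apply: mulrC.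
Qed.


(** * Curves in the level set with a prescribed tangent vector *)

Lemma is_derive_funM (f g : R -> R) (x a b : R) : is_derive x 1 f a -> is_derive x 1 g b ->
  is_derive x 1 (fun t => f t * g t) (f x * b + g x * a).
Proof. by move=> fa gb; exact: (is_deriveM (f := f) (g := g)). Qed.

Lemma is_derive_funD (f g : R -> R) (x a b : R) : is_derive x 1 f a -> is_derive x 1 g b ->
  is_derive x 1 (fun t => f t + g t) (a + b).
Proof. by move=> fa gb; exact: (is_deriveD (f := f) (g := g)). Qed.

Lemma is_derive_const (x c : R) : is_derive x 1 (fun=> c : R) (0 : R).
Proof. exact: is_derive_cst. Qed.

(* The curve is rational: its gamma-part runs along a great circle, in
   stereographic parametrization. *)
Lemma level_curve p X : level_set p -> dot p.1 X.1 = 0 ->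
  dot p.1 X.2 + dot p.2 X.1 = 0 ->
  exists c : R -> phase R, [/\ c 0 = p, forall t, level_set (c t) &
    is_diff (0 : R) c (fun t => t *: X)].
Proof.
case: p X => [x m] [y n] [] /=; rewrite !dotE => xx xm xy xnmy.
(* With [tau = |y| t / 2] one has [q t^2 = tau^2], so [al] and [|y| be] below are the rational
   cosine [(1 - tau^2) / (1 + tau^2)] and sine [2 tau / (1 + tau^2)]. Nothing is divided by [|y|],
   so [y = 0] is allowed. *)
pose q := (y 0 0 ^+ 2 + y 0 1 ^+ 2 + y 0 2%:R ^+ 2) / 4.
have q0 : 0 <= q by rewrite divr_ge0 // !addr_ge0 ?sqr_ge0.
pose w (t : R) := (1 + t * t * q)^-1.
have den t : 1 + t * t * q != 0.
  by rewrite gt_eqF // ltr_wpDr // mulr_ge0 // -expr2 sqr_ge0.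
pose mu := dot m y; pose nu := dot n y.
pose al t := 2 * w t + -1; pose be t := t * w t.
(* [s t] is the scalar product of [m + t n] with the gamma-part of the curve. Subtracting [s t]
   times that unit vector restores orthogonality, and [s] is of second order in [t], so the velocity
   at 0 stays [X]. *)
pose s t := t * (t * (w t * (mu * q * t + nu))).
pose sa t := - (s t * al t); pose sb t := - (s t * be t).
pose c t : phase R := (al t *: x + be t *: y, m + (t *: n + (sa t *: x + sb t *: y))).
have w0 : w 0 = 1 by rewrite /w !mul0r addr0 invr1.
exists c; split.
- rewrite /c /sa /sb /al /be /s w0 !mul0r oppr0 !scale0r !addr0 (_ : 2 * 1 + -1 = 1) ?scale1r //.
  by ring.
- move=> t.
  have c11 : dot (c t).1 (c t).1 = 1.
    rewrite dotE !mxE.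
    transitivity (al t ^+ 2 * (x 0 0 * x 0 0 + x 0 1 * x 0 1 + x 0 2%:R * x 0 2%:R)
      + 2 * al t * be t * (x 0 0 * y 0 0 + x 0 1 * y 0 1 + x 0 2%:R * y 0 2%:R)
      + 4 * be t ^+ 2 * q); first by rewrite /q; field.
    rewrite xx xy mulr1 mulr0 addr0 /al /be /w.
    by field.
  split => //=.
  transitivity (al t * (x 0 0 * m 0 0 + x 0 1 * m 0 1 + x 0 2%:R * m 0 2%:R)
     + be t * mu + t * al t * (dot x n) + t * be t * nu
     - s t * dot (c t).1 (c t).1); first by rewrite /mu /nu /c /sa /sb !dotE !mxE; ring.
  rewrite c11 xm (_ : dot x n = - mu); last first.
    by rewrite /mu !dotE; apply/eqP; rewrite -addr_eq0; apply/eqP.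
  by rewrite /s /al /be /w; field.
- have idd (t : R) : is_derive t 1 (fun u : R => u) (1 : R) by exact: is_derive_id.
  have wd : is_derive (0 : R) 1 w 0.
    have den0 := is_derive_funD (is_derive_const 0 1)
      (is_derive_funM (is_derive_funM (idd 0) (idd 0)) (is_derive_const 0 q)).
    have := @is_derive1_comp R (fun u => u^-1) (fun t => 1 + t * t * q) 0 _ _
      (is_derive_inv (den 0)) den0.
    by move=> /is_derive_eq; apply; ring.
  have ald : is_derive (0 : R) 1 al 0.
    have := is_derive_funD (is_derive_funM (is_derive_const 0 2) wd) (is_derive_const 0 (-1)).
    by move=> /is_derive_eq; apply; ring.
  have bed : is_derive (0 : R) 1 be 1.
    by have := is_derive_funM (idd 0) wd; move=> /is_derive_eq; apply; rewrite w0; ring.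
  have sd : is_derive (0 : R) 1 s 0.
    have := is_derive_funM (idd 0) (is_derive_funM (idd 0) (is_derive_funM wd
     (is_derive_funD (is_derive_funM (is_derive_const 0 (mu * q)) (idd 0)) (is_derive_const 0 nu)))).
    by move=> /is_derive_eq; apply; ring.
  have s0 : s 0 = 0 by rewrite /s mul0r.
  have sad : is_derive (0 : R) 1 sa 0.
    have := is_deriveN (is_derive_funM sd ald).
    by move=> /is_derive_eq; apply; rewrite s0; ring.
  have sbd : is_derive (0 : R) 1 sb 0.
    have := is_deriveN (is_derive_funM sd bed).
    by move=> /is_derive_eq; apply; rewrite s0 /be; ring.
  have dZ (k : R -> R) l (u : vec R) : is_derive (0 : R) 1 k l ->
      is_diff (0 : R) (fun t => k t *: u) (fun t => (t * l) *: u).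
    move=> /is_diff_scalar kl.
    exact: (is_diff_comp kl (is_diff_scalel (k 0) u)).
  have c1 := is_diffD (dZ _ _ x ald) (dZ _ _ y bed).
  have c2 := is_diffD (is_diff_cst m (0 : R)) (is_diffD (dZ _ _ n (idd 0))
     (is_diffD (dZ _ _ x sad) (dZ _ _ y sbd))).
  have := is_diff_pair c1 c2.
  move=> /is_diff_eq; apply; apply/funext => t /=.
  by congr pair; rewrite !fctE /= ?mulr0 ?mulr1 !scale0r ?add0r ?addr0.
Qed.

(** The tangent vector [X] is the velocity of a curve in the level set, along which [F] and [G]
    coincide near [p]; the derivatives at 0 are compared. *)
Lemma level_set_diff F G p w w' X : level_set p ->
  dot p.1 X.1 = 0 -> dot p.1 X.2 + dot p.2 X.1 = 0 ->
  is_grad F p w -> is_grad G p w' ->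
  (\forall q \near p, level_set q -> F q = G q) -> pairing w X = pairing w' X.
Proof.
move=> lp X1 X2 Fw Gw' FG; have [c [c0 cl cd]] := level_curve lp X1 X2.
rewrite -c0 in Fw Gw' FG.
have Fc := is_diff_comp cd Fw; have Gc := is_diff_comp cd Gw'.
have ccont : {for 0, continuous c}.
  by apply: differentiable_continuous; case: cd.
have FGc : \forall t \near (0 : R), (F \o c) t = (G \o c) t.
  have FG0 : \forall t \near (0 : R), level_set (c t) -> F (c t) = G (c t) := ccont _ FG.
  by move: FG0; apply: filterS => t; apply; exact: cl.
have := near_eq_derive (1 : R) FGc.
rewrite !deriveE; [|by case: Gc|by case: Fc].
rewrite (@diff_val _ _ _ _ _ _ _ Fc) (@diff_val _ _ _ _ _ _ _ Gc) /=.
by rewrite scale1r.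
Qed.

End Gradients.

(** * The Chaplygin bracket as a bivector, and its restriction to the level set *)

Lemma levi_civita_cyc (R : realType) (f : 'I_3 -> R) i j k : cyc i j k ->
  [/\ \sum_l levi_civita R i i l * f l = 0,
      \sum_l levi_civita R i j l * f l = f k &
      \sum_l levi_civita R j i l * f l = - f k].
Proof.
move=> cy; rewrite !(sum_cyc _ cy) /levi_civita.
case: cy => -> ->; move: i; apply: ord3; split; rewrite /= ?mulr1n ?mulr0n; ring.
Qed.

Section Bracket.
Variables (R : realType) (d : R) (I : 'I_3 -> R).

(** The Poisson bivector at [p], acting on the gradients [w] and [w']; the abstract relations are
    applied to this form. *)
Definition bracket_form (p w w' : phase R) : R :=
  \sum_i \sum_j
    (w.2 0 i * w'.2 0 j * brMM d I p.1 p.2 i j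
     + (w.2 0 i * w'.1 0 j - w.1 0 j * w'.2 0 i) * brMg d I p.1 i j).

Lemma bracketE F G p w w' : is_grad F p w -> is_grad G p w' ->
  bracket d I F G p = bracket_form p w w'.
Proof.
move=> Fw Gw'; apply: eq_bigr => i _; apply: eq_bigr => j _.
by rewrite !(partial_ME _ Fw) !(partial_ME _ Gw') !(partial_gammaE _ Fw) !(partial_gammaE _ Gw').
Qed.

Definition brK (p : phase R) k : R :=
  (gfun d I p.1)^-1 * p.2 0 k
     - d * gfun d I p.1 * dot p.2 (p.1 *m matA d I) * p.1 0 k.

Lemma brMM_cyc p i j k : cyc i j k ->
  (brMM d I p.1 p.2 i i = 0) * (brMM d I p.1 p.2 i j = brK p k) * (brMM d I p.1 p.2 j i = - brK p k).
Proof.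
move=> cy; rewrite /brMM -/(brK p).
by have [-> -> ->] := levi_civita_cyc (brK p) cy.
Qed.

Lemma brMg_cyc (x : vec R) i j k : cyc i j k ->
  (brMg d I x i i = 0) * (brMg d I x i j = (gfun d I x)^-1 * x 0 k) *
  (brMg d I x j i = - ((gfun d I x)^-1 * x 0 k)).
Proof.
move=> cy; have E a b : brMg d I x a b = \sum_l levi_civita R a b l * ((gfun d I x)^-1 * x 0 l).
  by apply: eq_bigr => l _; rewrite mulrA.
rewrite !E.
by have [-> -> ->] := levi_civita_cyc (fun l => (gfun d I x)^-1 * x 0 l) cy.
Qed.

Lemma bracket_formE p w w' (c := (gfun d I p.1)^-1) (K := brK p) :
  bracket_form p w w' =
    (w.2 0 0 * w'.2 0 1 - w.2 0 1 * w'.2 0 0) * K 2%:R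
  + (w.2 0 1 * w'.2 0 2%:R - w.2 0 2%:R * w'.2 0 1) * K 0
  + (w.2 0 2%:R * w'.2 0 0 - w.2 0 0 * w'.2 0 2%:R) * K 1
  + c * ((w.2 0 0 * w'.1 0 1 - w.1 0 1 * w'.2 0 0 - (w.2 0 1 * w'.1 0 0 - w.1 0 0 * w'.2 0 1)) * p.1 0 2%:R
  + (w.2 0 1 * w'.1 0 2%:R - w.1 0 2%:R * w'.2 0 1 - (w.2 0 2%:R * w'.1 0 1 - w.1 0 1 * w'.2 0 2%:R)) * p.1 0 0
  + (w.2 0 2%:R * w'.1 0 0 - w.1 0 0 * w'.2 0 2%:R - (w.2 0 0 * w'.1 0 2%:R - w.1 0 2%:R * w'.2 0 0)) * p.1 0 1).
Proof.
have c0 : cyc 0 1 2%:R by split; apply/eqP.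
have c1 := cycS c0; have c2 := cycS c1.
rewrite /bracket_form !(sum_cyc _ c0) !(brMM_cyc p c0) !(brMM_cyc p c1) !(brMM_cyc p c2).
rewrite !(brMg_cyc _ c0) !(brMg_cyc _ c1) !(brMg_cyc _ c2) -/c -/K.
by ring.
Qed.

Lemma bracket_form_linear p a u v w :
  bracket_form p (a *: u + v) w = a * bracket_form p u w + bracket_form p v w.
Proof. by rewrite !bracket_formE /= !mxE; ring. Qed.

Lemma bracket_formC p u v : bracket_form p u v = - bracket_form p v u.
Proof. by rewrite !bracket_formE; ring. Qed.

(* The Hamiltonian vector fields of the bracket are tangent to the level set. *)
Lemma bracket_form_tangent p w :
  exists X : phase R, [/\ dot p.1 X.1 = 0, dot p.1 X.2 + dot p.2 X.1 = 0 &
    forall w', bracket_form p w' w = pairing w' X].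
Proof.
pose c := (gfun d I p.1)^-1; pose K := brK p.
pose s := d * gfun d I p.1 * dot p.2 (p.1 *m matA d I).
pose cr (u v : 'I_3 -> R) : vec R := \row_i (u (i + 1) * v (i + 2%:R) - u (i + 2%:R) * v (i + 1)).
exists (c *: cr (w.2 0) (p.1 0), cr (w.2 0) K + c *: cr (w.1 0) (p.1 0)).
have a1 : (0 + 1 = 1 :> 'I_3) * (0 + 2%:R = 2%:R :> 'I_3) * (1 + 1 = 2%:R :> 'I_3) *
  (1 + 2%:R = 0 :> 'I_3) * (2%:R + 1 = 0 :> 'I_3) * (2%:R + 2%:R = 1 :> 'I_3).
  by do !split; apply/eqP.
(* Since [K] is [c M - s gamma], the second tangency condition reduces to the skew symmetry of the
   triple product. *)
have KE k : K k = c * p.2 0 k - s * p.1 0 k by [].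
split.
- by rewrite dotE /= !mxE !a1; ring.
- by rewrite !dotE /= !mxE !a1 !KE; ring.
- by move=> w'; rewrite bracket_formE -/c -/K /pairing !dotE /= !mxE !a1; ring.
Qed.

(** Two extensions of one function have gradients that agree on tangent vectors, in particular on
    Hamiltonian ones, so a single pair of extensions determines the value. The extensions are
    exchanged one at a time, the second by skew symmetry. *)
Lemma level_bracketI f h F G p w w' v : level_set p ->
  (\forall q \near p, level_set q -> F q = f q) ->
  (\forall q \near p, level_set q -> G q = h q) ->
  is_grad F p w -> is_grad G p w' -> bracket_form p w w' = v ->
  level_bracket d I f h p v.
Proof.
move=> lp Ff Gh Fw Gw' <-.
have key F1 G1 w1 w2 w3 : is_grad F1 p w1 -> is_grad G1 p w2 ->
    (\forall q \near p, level_set q -> F1 q = G1 q) ->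
    bracket_form p w1 w3 = bracket_form p w2 w3.
  move=> F1w G1w FG; have [X [X1 X2 XE]] := bracket_form_tangent p w3.
  by rewrite !XE; apply: level_set_diff FG.
split; [by exists F; split=> //; case: Fw|by exists G; split=> //; case: Gw'|].
move=> F1 G1 [/differentiable_is_grad[w1 Fw1] F1f] [/differentiable_is_grad[w1' Gw1] G1h].
rewrite (bracketE Fw1 Gw1) (key _ _ _ _ _ Fw1 Fw); last first.
  by apply: filterS2 F1f Ff => q E1 E2 lq; rewrite E1 // E2.
rewrite bracket_formC (key _ _ _ _ _ Gw1 Gw') -?bracket_formC //.
by apply: filterS2 G1h Gh => q E1 E2 lq; rewrite E1 // E2.
Qed.

Lemma bracket_form_coord p :
  lie_rel (bracket_form p) (p.1 0) (brK p) (gfun d I p.1)^-1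
    (fun i => (delta_mx 0 i, 0)) (fun i => (0, delta_mx 0 i)).
Proof.
move=> i j k cy; have cy1 := cycS cy; have cy2 := cycS cy1.
have nq := (cyc_neq cy, cyc_neq cy1, cyc_neq cy2, eqxx).
rewrite /bracket_form !(sum_cyc _ cy) /= !mxE !nq /= ?mulr1n ?mulr0n.
rewrite !(brMM_cyc p cy) !(brMM_cyc p cy1) !(brMM_cyc p cy2).
rewrite !(brMg_cyc _ cy) !(brMg_cyc _ cy1) !(brMg_cyc _ cy2).
split; ring.
Qed.

Lemma lie_rel_brMM (q : phase R) p (dx dm : 'I_3 -> phase R) :
  lie_rel (bracket_form p) (q.1 0) (brK q) (gfun d I q.1)^-1 dx dm ->
  forall i j,
  [/\ bracket_form p (dm i) (dm j) = brMM d I q.1 q.2 i j,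
      bracket_form p (dm i) (dx j) = brMg d I q.1 i j &
      bracket_form p (dx i) (dx j) = 0].
Proof.
move=> H i j; have brC := bracket_formC p.
have brv u : bracket_form p u u = 0 by have := brC u u; lra.
have [<-|/eqP/nesym/cyc_ex [k [cy|cy]]] := eqVneq i j.
- have cy : cyc i (i + 1) (i + 2%:R) by [].
  have T := lie_relP brC H cy.
  by rewrite (brMM_cyc q cy) (brMg_cyc q.1 cy) !T !brv.
- by have T := lie_relP brC H cy; rewrite (brMM_cyc q cy) (brMg_cyc q.1 cy) !T.
- by have T := lie_relP brC H cy; rewrite (brMM_cyc q cy) (brMg_cyc q.1 cy) !T.
Qed.

End Bracket.

Lemma dot_sum (R : realType) (u v : vec R) : dot u v = \sum_l u 0 l * v 0 l.
Proof. by rewrite /dot mxE; apply: eq_bigr => l _; rewrite mxE. Qed.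

Lemma cyc_add (i : 'I_3) : cyc i (i + 1) (i + 2%:R).
Proof. by []. Qed.

Lemma ord3_add : (0 + 1 = 1 :> 'I_3) * (0 + 2%:R = 2%:R :> 'I_3) * (1 + 1 = 2%:R :> 'I_3) *
  (1 + 2%:R = 0 :> 'I_3) * (2%:R + 1 = 0 :> 'I_3) * (2%:R + 2%:R = 1 :> 'I_3).
Proof. by do !split; apply/eqP. Qed.

Lemma is_grad_eq (R : realType) (F G : phase R -> R) p w w' :
  is_grad F p w -> F =1 G -> w = w' -> is_grad G p w'.
Proof. by move=> Fw /funext <- <-. Qed.

(** * Positivity, cross products and the solution of the implicit equations *)

Section Transformation.
Variables (R : realType) (d : R) (I : 'I_3 -> R).
Hypotheses (d_ge0 : 0 <= d) (I_gt0 : forall k, 0 < I k).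
Implicit Types (p q : phase R) (x t : vec R).

Let a := acoef d I.
Let b i := 1 - a i * d.
Let beta i := Num.sqrt (b i).

(** Indeed [b i = I i / (I i + d)]. *)
Lemma b_gt0 i : 0 < b i.
Proof.
rewrite /b /a /acoef subr_gt0 mulrC ltr_pdivrMr ?mul1r ?ltrDr //.
by rewrite ltr_wpDr.
Qed.

Lemma beta_gt0 i : 0 < beta i.
Proof. by rewrite sqrtr_gt0 b_gt0. Qed.

Lemma beta_neq0 i : beta i != 0.
Proof. by rewrite gt_eqF ?beta_gt0. Qed.

Lemma sqr_beta i : beta i ^+ 2 = b i.
Proof. by rewrite sqr_sqrtr // ltW ?b_gt0. Qed.

Definition radicand x := 1 - d * \sum_l a l * (x 0 l * x 0 l).

Lemma gfunE x : gfun d I x = (Num.sqrt (radicand x))^-1.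
Proof.
rewrite /gfun /radicand dot_sum; congr (Num.sqrt (1 - d * _))^-1.
by apply: eq_bigr => l _; rewrite /matA mul_mx_diag !mxE /a; ring.
Qed.

Lemma radicand_unit x : dot x x = 1 -> radicand x = \sum_l b l * (x 0 l * x 0 l).
Proof.
by rewrite /radicand /b dotE !sum3E => xx; rewrite -[X in X - _]xx; ring.
Qed.

Lemma radicand_gt0 x : dot x x = 1 -> 0 < radicand x.
Proof.
move=> xx; rewrite (radicand_unit xx).
have t_ge0 l : 0 <= b l * (x 0 l * x 0 l).
  by apply: mulr_ge0; [exact/ltW/b_gt0 | rewrite -expr2 sqr_ge0].
rewrite lt_neqAle sumr_ge0 // andbT eq_sym; apply/negP.
rewrite psumr_eq0 // => /allP h; move: xx; rewrite dot_sum big1 => [/eqP|l _].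
  by rewrite eq_sym oner_eq0.
have /eqP/eqP := h l (mem_index_enum _).
by rewrite mulf_eq0 gt_eqF ?b_gt0 //= => /eqP.
Qed.

Lemma gfun_gt0 x : 0 < radicand x -> 0 < gfun d I x.
Proof. by move=> x0; rewrite gfunE invr_gt0 sqrtr_gt0. Qed.

Lemma sqr_gfun x : 0 < radicand x -> gfun d I x ^+ 2 = (radicand x)^-1.
Proof. by move=> x0; rewrite gfunE exprVn sqr_sqrtr // ltW. Qed.

Definition cross q i := q.1 0 (i + 1) * q.2 0 (i + 2%:R) - q.1 0 (i + 2%:R) * q.2 0 (i + 1).

Lemma cross_cyc q i j k : cyc i j k -> cross q i = q.1 0 j * q.2 0 k - q.1 0 k * q.2 0 j.
Proof. by case=> -> ->. Qed.


Lemma H1E x m : H1 d I x m = \sum_l a l * (m 0 l * m 0 l)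
    + d * gfun d I x ^+ 2 * (\sum_l a l * x 0 l * m 0 l) ^+ 2.
Proof.
have E : dot m (x *m matA d I) = \sum_l a l * x 0 l * m 0 l.
  by rewrite dot_sum; apply: eq_bigr => l _; rewrite /matA mul_mx_diag !mxE /a; ring.
rewrite /H1 /matAg mulmxDr -scalemxAr (mulmxA m).
rewrite [m *m _^T]mx11_scalar mul_scalar_mx -/(dot _ _) -E.
rewrite [LHS]dot_sum [dot _ _]dot_sum !sum3E /matA !mul_mx_diag !mxE /a.
by ring.
Qed.

(* [d H1 - H2] is, up to a factor, a diagonal quadratic form in [gamma x M]. *)
Lemma H1_cross q : level_set q ->
  d * H1 d I q.1 q.2 - H2 q.2 =
    - (gfun d I q.1 ^+ 2 * (b 0 * b 1 * b 2%:R) * \sum_l (b l)^-1 * cross q l ^+ 2).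
Proof.
case=> xx xm; have r0 := radicand_gt0 xx; rewrite H1E sqr_gfun //.
have rE := radicand_unit xx; have r_neq0 : radicand q.1 != 0 by rewrite gt_eqF.
(* Substitute [d A = 1 - B] with [B = diag(b)]. *)
have -> : d * (\sum_l a l * (q.2 0 l * q.2 0 l) + d * (radicand q.1)^-1 * (\sum_l a l * q.1 0 l * q.2 0 l) ^+ 2)
   - H2 q.2 = (dot q.1 q.2 - \sum_l b l * q.1 0 l * q.2 0 l) ^+ 2 / radicand q.1
     - \sum_l b l * (q.2 0 l * q.2 0 l).
  by rewrite /H2 !dotE !sum3E /b; field.
rewrite xm sub0r sqrrN; apply: (mulfI r_neq0).
(* After clearing the radicand [(x, B x)] this is Lagrange's identity for the scalar product
   [(u, B v)]; the coefficient of the squared [l]-th coordinate of the cross product is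
   [b_0 b_1 b_2 / b_l]. *)
transitivity ((\sum_l b l * q.1 0 l * q.2 0 l) ^+ 2
   - (\sum_l b l * (q.1 0 l * q.1 0 l)) * (\sum_l b l * (q.2 0 l * q.2 0 l))).
  by rewrite -rE; field.
rewrite mulrN mulrA [_ * (_ * (b 0 * _ * _))]mulrA mulfV // mul1r.
rewrite !sum3E /cross !ord3_add.
by field; rewrite !gt_eqF ?b_gt0.
Qed.

Lemma sum_cross_sqr q : level_set q -> \sum_l cross q l ^+ 2 = H2 q.2.
Proof.
case=> xx xm; rewrite /H2 !dotE in xx xm *.
transitivity ((q.1 0 0 * q.1 0 0 + q.1 0 1 * q.1 0 1 + q.1 0 2%:R * q.1 0 2%:R) *
  (q.2 0 0 * q.2 0 0 + q.2 0 1 * q.2 0 1 + q.2 0 2%:R * q.2 0 2%:R) -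
  (q.1 0 0 * q.2 0 0 + q.1 0 1 * q.2 0 1 + q.1 0 2%:R * q.2 0 2%:R) ^+ 2).
  by rewrite !sum3E /cross !ord3_add; ring.
by rewrite xx xm; ring.
Qed.

(** For [M] nonzero, [gamma], [M / |M|] and their cross product form an orthonormal basis, so the
    squares of their [i]-th coordinates add up to 1. This turns the numerator in [is_tgamma] into a
    square. *)
Lemma cross_sqr q i j k : level_set q -> cyc i j k ->
  cross q i ^+ 2 = q.2 0 j ^+ 2 + q.2 0 k ^+ 2 - q.1 0 i ^+ 2 * H2 q.2.
Proof.
case=> xx xm cy; move: xx xm; rewrite /H2 !dot_sum !(sum_cyc _ cy) (cross_cyc _ cy).
move=> xx xm.
transitivity ((q.1 0 i * q.1 0 i + q.1 0 j * q.1 0 j + q.1 0 k * q.1 0 k) *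
   (q.2 0 j ^+ 2 + q.2 0 k ^+ 2) -
   q.1 0 i ^+ 2 * (q.2 0 i * q.2 0 i + q.2 0 j * q.2 0 j + q.2 0 k * q.2 0 k)
   - (q.1 0 i * q.2 0 i + q.1 0 j * q.2 0 j + q.1 0 k * q.2 0 k) *
   (q.1 0 j * q.2 0 j + q.1 0 k * q.2 0 k - q.1 0 i * q.2 0 i)); first by ring.
by rewrite xx xm; ring.
Qed.

Lemma H2_gt0 (m : vec R) : m != 0 -> 0 < H2 m.
Proof.
move=> m0; rewrite /H2 dot_sum lt_neqAle sumr_ge0 ?andbT => [|l _]; last first.
  by rewrite -expr2 sqr_ge0.
rewrite eq_sym; apply: contraNneq m0 => /eqP.
rewrite psumr_eq0 => [/allP h|l _]; last by rewrite -expr2 sqr_ge0.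
apply/eqP/rowP => l; rewrite mxE; apply/eqP.
by have := h l (mem_index_enum _); rewrite mulf_eq0 orbb.
Qed.

Definition wsum q := \sum_l (b l)^-1 * cross q l ^+ 2.

Lemma wsum_gt0 q : level_set q -> q.2 != 0 -> 0 < wsum q.
Proof.
move=> lq m0; have m2 := H2_gt0 m0; rewrite -(sum_cross_sqr lq) in m2.
apply: lt_le_trans m2 _; apply: ler_sum => l _.
rewrite ler_peMl ?sqr_ge0 // invf_ge1 ?b_gt0 // /b gerBl mulr_ge0 // /a /acoef.
by rewrite invr_ge0 addr_ge0 // ltW.
Qed.

(** The equations make [t_i^2] equal to [cross_i^2 / b_i] times the factor [radicand t / H2].
    Summing with weights [b_i] gives [(t, B t) = radicand t], while by definition
    [radicand t = 1 - |t|^2 + (t, B t)]; hence [|t| = 1]. The unweighted sum then determines the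
    radicand. *)
Lemma is_tgammaP q t : level_set q -> q.2 != 0 -> is_tgamma d I q.1 q.2 t ->
  [/\ dot t t = 1, radicand t = H2 q.2 / wsum q &
      forall i, t 0 i ^+ 2 = (b i)^-1 * cross q i ^+ 2 / wsum q].
Proof.
move=> lq m0 tE; have m2 := H2_gt0 m0; have w0 := wsum_gt0 lq m0.
have m2n : H2 q.2 != 0 by rewrite gt_eqF.
have wn : wsum q != 0 by rewrite gt_eqF.
have bn i : b i != 0 by rewrite gt_eqF ?b_gt0.
have {}tE i : t 0 i ^+ 2 = (b i)^-1 * cross q i ^+ 2 / H2 q.2 / gfun d I t ^+ 2.
  rewrite (tE i _ _ (cyc_uniq (cyc_add i))) (cross_sqr lq (cyc_add i)).
  have -> : q.1 0 0 ^+ 2 + q.1 0 1 ^+ 2 + q.1 0 2%:R ^+ 2 = 1.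
    by rewrite !expr2 -dotE; case: lq.
  have -> : q.2 0 0 ^+ 2 + q.2 0 1 ^+ 2 + q.2 0 2%:R ^+ 2 = H2 q.2.
    by rewrite /H2 dotE !expr2.
  have -> : acoef d I i * d - 1 = - b i by rewrite /b opprB.
  (* If tilde g is 0, both sides are 0 by the convention [0^-1 = 0]; this case is excluded next. *)
  have [->|gn] := eqVneq (gfun d I t) 0.
    by rewrite expr0n /= mulr0 invr0 !mulr0 mul0r.
  by field; rewrite gn m2n bn.
have r0 : 0 < radicand t.
  rewrite ltNge; apply/negP => r0.
  have g0 : gfun d I t = 0 by rewrite gfunE ler0_sqrtr // invr0.
  have t0 i : t 0 i = 0.
    by apply/eqP; rewrite -sqrf_eq0 tE g0 expr0n /= invr0 mulr0.
  by move: r0; rewrite /radicand big1 => [|l _]; rewrite ?t0 ?mulr0 // subr0 ler10.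
have {}tE i : t 0 i ^+ 2 = (b i)^-1 * cross q i ^+ 2 / H2 q.2 * radicand t.
  by rewrite tE sqr_gfun // invrK.
have tt : dot t t = 1.
  have : \sum_l b l * t 0 l ^+ 2 = radicand t.
    transitivity ((\sum_l cross q l ^+ 2) / H2 q.2 * radicand t).
      by rewrite !sum3E !tE; field; rewrite m2n !bn.
    by rewrite sum_cross_sqr // divff // mul1r.
  rewrite /radicand /b dotE !sum3E => h.
  lra.
have rE : radicand t = H2 q.2 / wsum q.
  have : dot t t = wsum q / H2 q.2 * radicand t.
    rewrite dot_sum /wsum !sum3E -!expr2 !tE; field.
    by rewrite m2n !bn.
  rewrite tt => h; apply: (mulfI (_ : wsum q / H2 q.2 != 0)).
    by rewrite mulf_neq0 ?invr_eq0.
  by rewrite -h; field; rewrite m2n wn.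
by split => // i; rewrite tE rE; field; rewrite m2n wn bn.
Qed.


(* In the notation of the header, [momentum] is [g M], [mom] is [p], [scaled] is
   [c], [vdir] is [v], [lam] is [Lambda]; [kap] is the inverse of tilde g. *)
Definition momentum i q := gfun d I q.1 * q.2 0 i.

Definition mom i q :=
  q.1 0 (i + 1) * momentum (i + 2%:R) q - q.1 0 (i + 2%:R) * momentum (i + 1) q.

Definition scaled i q := (beta i)^-1 * mom i q.

Definition vdir i q := (Num.sqrt (\sum_l scaled l q * scaled l q))^-1 * scaled i q.

Definition lam i q :=
  (beta (i + 1))^-1 * beta (i + 2%:R) * (mom (i + 1) q * q.1 0 (i + 2%:R))
  - (beta (i + 2%:R))^-1 * beta (i + 1) * (mom (i + 2%:R) q * q.1 0 (i + 1)).

Definition vsign (s : 'I_3 -> R) i q := s i * vdir i q.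

Definition lsign (s : 'I_3 -> R) i q := s (i + 1) * s (i + 2%:R) * lam i q.

Definition kap s q := Num.sqrt (1 - d * \sum_l a l * (vsign s l q * vsign s l q)).

Lemma momE i q : mom i q = gfun d I q.1 * cross q i.
Proof. by rewrite /mom /momentum /cross; ring. Qed.

Lemma sum_scaled_sqr q : \sum_l scaled l q * scaled l q = gfun d I q.1 ^+ 2 * wsum q.
Proof.
rewrite /wsum mulr_sumr; apply: eq_bigr => l _.
by rewrite /scaled momE -sqr_beta; field; rewrite beta_neq0.
Qed.

Lemma sum_scaled_sqr_gt0 q : level_set q -> q.2 != 0 -> 0 < \sum_l scaled l q * scaled l q.
Proof.
move=> lq m0; rewrite sum_scaled_sqr mulr_gt0 ?wsum_gt0 // exprn_gt0 //.
by apply/gfun_gt0/radicand_gt0; case: lq.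
Qed.

Lemma vdir_sqr i q : level_set q -> q.2 != 0 ->
  vdir i q ^+ 2 = (b i)^-1 * cross q i ^+ 2 / wsum q.
Proof.
move=> lq m0; have S0 := sum_scaled_sqr_gt0 lq m0; have w0 := wsum_gt0 lq m0.
have g0 : gfun d I q.1 != 0 by rewrite gt_eqF // gfun_gt0 // radicand_gt0 //; case: lq.
rewrite /vdir exprMn exprVn sqr_sqrtr ?ltW // sum_scaled_sqr /scaled momE -sqr_beta.
by field; rewrite g0 beta_neq0 gt_eqF.
Qed.

(** [vdir] is parallel to [scaled], and [lam] is a cross product with [scaled] as a factor; the sign
    [s 0 * s 1 * s 2] is common to all terms. *)
Lemma sum_vsign_lsign s q : \sum_l vsign s l q * lsign s l q = 0.
Proof.
rewrite sum3E /vsign /lsign /vdir /lam /scaled !ord3_add.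
set r := (Num.sqrt _)^-1.
by field; rewrite !beta_neq0.
Qed.

(** * Gradients and brackets of the transformed coordinates *)

Section Gradients.
Variable p : phase R.
Hypotheses (lp : level_set p) (M_neq0 : p.2 != 0).
Variable s : 'I_3 -> R.
Hypothesis s_sqr : forall i, s i ^+ 2 = 1.

Let g0 : 0 < gfun d I p.1.
Proof. by apply/gfun_gt0/radicand_gt0; case: lp. Qed.

Let dx i : phase R := (delta_mx 0 i, 0).
Let dm i : phase R := (0, delta_mx 0 i).

(** The second term is [M_i] times the gradient [d g^3 A gamma] of g. This covector and the
    following ones have the shape that the lemmas on Poisson relations require. *)
Definition dmomentum i : phase R := gfun d I p.1 *: dm i
  + (p.2 0 i * (d * gfun d I p.1 ^+ 3)) *: \sum_l (a l * p.1 0 l) *: dx l.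

Definition dmom i : phase R :=
  (p.1 0 (i + 1) *: dmomentum (i + 2%:R) + momentum (i + 2%:R) p *: dx (i + 1))
  - (p.1 0 (i + 2%:R) *: dmomentum (i + 1) + momentum (i + 1) p *: dx (i + 2%:R)).

Let r := (Num.sqrt (\sum_l scaled l p * scaled l p))^-1.

Definition dvdir i : phase R := (r * (beta i)^-1) *: dmom i
   - (r ^+ 3 * ((beta i)^-1 * mom i p)) *: \sum_l ((beta l)^-1 ^+ 2 * mom l p) *: dmom l.

Definition dlam i : phase R :=
  ((beta (i + 1))^-1 * beta (i + 2%:R)) *: (mom (i + 1) p *: dx (i + 2%:R) + p.1 0 (i + 2%:R) *: dmom (i + 1))
  - ((beta (i + 2%:R))^-1 * beta (i + 1)) *: (mom (i + 2%:R) p *: dx (i + 1) + p.1 0 (i + 1) *: dmom (i + 2%:R)).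

Definition dlsign i : phase R := (s (i + 1) * s (i + 2%:R)) *: dlam i.

Definition dtM i : phase R := kap s p *: dlsign i
  - (lsign s i p * (d * (kap s p)^-1)) *: \sum_l (a l * vsign s l p) *: (s l *: dvdir l).

Lemma is_grad_gfun : is_grad (fun q => gfun d I q.1) p
  ((d * gfun d I p.1 ^+ 3) *: \sum_l (a l * p.1 0 l) *: dx l).
Proof.
have rg : is_grad (fun q => radicand q.1) p
    (- (d * 2) *: \sum_l (a l * p.1 0 l) *: dx l).
  have := is_gradB (is_grad_cst 1 p) (is_gradZ d (is_grad_sum (fun l =>
    is_gradZ (a l) (is_gradM (is_grad_coord_gamma l p) (is_grad_coord_gamma l p))))).
  move=> /is_grad_eq; apply=> //.
  rewrite sub0r -scaleNr -mulNr -scalerA; congr (_ *: _); rewrite scaler_sumr.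
  apply: eq_bigr => l _; rewrite -scalerDl !scalerA; congr (_ *: _); ring.
have r0 : 0 < radicand p.1 by apply: radicand_gt0; case: lp.
have := is_grad_comp (is_derive_invsqrt r0) rg.
move=> /is_grad_eq; apply=> [q|]; first by rewrite gfunE.
by rewrite scalerA gfunE; congr (_ *: _); field; rewrite gt_eqF // sqrtr_gt0.
Qed.

Lemma is_grad_momentum i : is_grad (momentum i) p (dmomentum i).
Proof.
have := is_gradM is_grad_gfun (is_grad_coord_M i p).
by move=> /is_grad_eq; apply=> //; rewrite scalerA.
Qed.

Lemma is_grad_mom i : is_grad (mom i) p (dmom i).
Proof.
exact: (is_gradB (is_gradM (is_grad_coord_gamma _ p) (is_grad_momentum _))
  (is_gradM (is_grad_coord_gamma _ p) (is_grad_momentum _))).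
Qed.

Lemma is_grad_vdir i : is_grad (vdir i) p (dvdir i).
Proof.
have cg l := is_gradZ (beta l)^-1 (is_grad_mom l).
have rg := is_grad_comp (is_derive_invsqrt (sum_scaled_sqr_gt0 lp M_neq0))
   (is_grad_sum (fun l => is_gradM (cg l) (cg l))).
have := is_gradM rg (cg i).
move=> /is_grad_eq; apply=> //; rewrite /dvdir scalerA -/r.
congr (_ + _); rewrite scalerA !scaler_sumr -sumrN.
apply: eq_bigr => l _; rewrite -scalerDl !scalerA -[RHS]scaleNr; congr (_ *: _).
by rewrite -/r; field; rewrite !beta_neq0.
Qed.

Lemma is_grad_lam i : is_grad (lam i) p (dlam i).
Proof.
exact: (is_gradB (is_gradZ _ (is_gradM (is_grad_mom _) (is_grad_coord_gamma _ p)))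
  (is_gradZ _ (is_gradM (is_grad_mom _) (is_grad_coord_gamma _ p)))).
Qed.


(** The factors [1 - d a_l = b_l] cancel the weights [1 / b_l], which leaves the sum of the squares
    of [cross]. *)
Lemma kap_arg_eq : 1 - d * \sum_l a l * (vsign s l p * vsign s l p) = H2 p.2 / wsum p.
Proof.
have w0 := wsum_gt0 lp M_neq0; have wn : wsum p != 0 by rewrite gt_eqF.
have bn i : b i != 0 by rewrite gt_eqF ?b_gt0.
have sq l : vsign s l p * vsign s l p = (b l)^-1 * cross p l ^+ 2 / wsum p.
  by rewrite -expr2 /vsign exprMn s_sqr mul1r vdir_sqr.
rewrite !sum3E !sq -(sum_cross_sqr lp) !sum3E.
apply: (mulIf wn); rewrite divfK // mulrBl mul1r {1}/wsum sum3E.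
have ad l : d * a l = 1 - b l by rewrite /b; ring.
transitivity ((b 0)^-1 * cross p 0 ^+ 2 * (1 - d * a 0)
  + (b 1)^-1 * cross p 1 ^+ 2 * (1 - d * a 1)
  + (b 2%:R)^-1 * cross p 2%:R ^+ 2 * (1 - d * a 2%:R)).
  by field; rewrite wn !bn.
by rewrite !ad; field; rewrite !bn.
Qed.

Lemma kap_arg_gt0 : 0 < 1 - d * \sum_l a l * (vsign s l p * vsign s l p).
Proof. by rewrite kap_arg_eq divr_gt0 ?wsum_gt0 ?H2_gt0. Qed.

Lemma is_grad_vsign i : is_grad (vsign s i) p (s i *: dvdir i).
Proof. exact: is_gradZ (is_grad_vdir i). Qed.

Lemma is_grad_tM i : is_grad (fun q => kap s q * lsign s i q) p (dtM i).
Proof.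
have k0 := kap_arg_gt0.
have kd : is_grad (kap s) p (- (d * (kap s p)^-1) *: \sum_l (a l * vsign s l p) *: (s l *: dvdir l)).
  have := is_gradB (is_grad_cst 1 p) (is_gradZ d (is_grad_sum (fun l =>
    is_gradZ (a l) (is_gradM (is_grad_vsign l) (is_grad_vsign l))))).
  move/(is_grad_comp (is_derive1_sqrt k0))/is_grad_eq; apply=> //.
  have ->  (u : phase R) : 0 - d *: u = (- d) *: u by rewrite sub0r scaleNr.
  rewrite scalerA !scaler_sumr.
  apply: eq_bigr => l _; rewrite -scalerDl !scalerA; congr (_ *: _).
  rewrite -/(kap s p).
  field; rewrite gt_eqF // sqrtr_gt0; exact: k0.
have := is_gradM kd (is_gradZ (s (i + 1) * s (i + 2%:R)) (is_grad_lam i)).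
move=> /is_grad_eq; apply=> //.
by rewrite /dtM; congr (_ + _); rewrite scalerA mulrN scaleNr.
Qed.

Let br := bracket_form d I p.

(** [L1] to [L4] treat in turn (gamma, g M), (gamma, p), (v, Lambda) and its signed copy;
    [lie_rel_rescale] with [(kap s p)^-1] in the place of g then gives the Chaplygin form. *)
Lemma lie_rel_tM :
  lie_rel br (vsign s ^~ p) (fun k => kap s p * (kap s p * lsign s k p)
      - d * (kap s p)^-1 * (\sum_l a l * vsign s l p * (kap s p * lsign s l p)) * vsign s k p)
   (kap s p) (fun i => s i *: dvdir i) dtM.
Proof.
have brl := bracket_form_linear d I p; have brC := bracket_formC d I p.
have [xx xm] := lp; rewrite !dot_sum in xx xm.
have L1 : lie_rel br (p.1 0) (momentum ^~ p) 1 dx dmomentum.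
  apply: (lie_rel_momentum brl brC (lt0r_neq0 g0) xm (fun i => erefl) (fun i => erefl)).
  move=> i j k cy; have := bracket_form_coord d I p cy.
  rewrite /brK [dot _ _](_ : _ = \sum_l a l * p.1 0 l * p.2 0 l) //.
  by rewrite dot_sum; apply: eq_bigr => l _; rewrite /matA mul_mx_diag !mxE /a; ring.
have L2 : dirac_rel br (p.1 0) (mom ^~ p) dx dmom.
  apply: (dirac_rel_cross brl brC xx _ _ _ L1).
  - rewrite -[RHS](mulr0 (gfun d I p.1)) -[in RHS]xm mulr_sumr.
    by apply: eq_bigr => l _; rewrite /momentum; ring.
  - by move=> i j k [-> ->].
  - by move=> i j k [-> ->].
have S0 := sum_scaled_sqr_gt0 lp M_neq0.
have L3 : lie_rel br (vdir ^~ p) (lam ^~ p) 1 dvdir dlam.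
  have r0 : r != 0 by rewrite invr_eq0 gt_eqF // sqrtr_gt0.
  have rE : r ^+ 2 * \sum_i ((beta i)^-1 * mom i p) ^+ 2 = 1.
    have <- : \sum_l scaled l p * scaled l p = \sum_i ((beta i)^-1 * mom i p) ^+ 2.
      by apply: eq_bigr => l _; rewrite expr2.
    by rewrite /r exprVn sqr_sqrtr ?ltW // mulVf // gt_eqF.
  refine (lie_rel_cotangent_lift brl brC (dv := dvdir) (dLam := dlam) beta_neq0 r0 rE
    (fun i => erefl) (fun i => erefl) _ _ L2).
  - by move=> i j k [-> ->].
  - by move=> i j k [-> ->].
have L4 : lie_rel br (vsign s ^~ p) (lsign s ^~ p) 1 (fun i => s i *: dvdir i) dlsign.
  apply: (lie_rel_sign brl brC s_sqr _ _ L3) => //.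
  by move=> i j k [-> ->].
have k0 : (kap s p)^-1 != 0 by rewrite invr_eq0 gt_eqF // sqrtr_gt0 kap_arg_gt0.
have := lie_rel_rescale (d := d) brl brC (a := a) k0 _ _ L4.
rewrite invrK; apply.
- exact: sum_vsign_lsign.
- by [].
Qed.

End Gradients.

(** * Signs of the square roots *)

Lemma kapE s q t : (forall i, t 0 i = vsign s i q) -> kap s q = (gfun d I t)^-1.
Proof.
move=> tE; rewrite gfunE invrK /kap /radicand; congr (Num.sqrt (1 - d * _)).
by apply: eq_bigr => l _; rewrite !tE.
Qed.

(** With the entries of [M] collected into cross products, the formula involves tilde gamma only
    through the ratios [t_j / t_k], and these equal [s_j s_k (beta_k cross_j) / (beta_j cross_k)]
    because a sign is its own inverse. The denominators [cross_k] cancel. *)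
Lemma tM_signed s q t tM : (forall i, s i ^+ 2 = 1) ->
  (forall i, t 0 i = vsign s i q) -> (forall i, t 0 i != 0) ->
  is_tM d I q.1 q.2 t tM -> forall i, tM 0 i = kap s q * lsign s i q.
Proof.
move=> s2 tE t0 tME i; have cy := cyc_add i.
rewrite (tME _ _ _ (cyc_uniq cy)) (kapE tE).
pose e := (Num.sqrt (\sum_l scaled l q * scaled l q))^-1 * gfun d I q.1.
have tjE j : t 0 j = s j * (e * ((beta j)^-1 * cross q j)).
  by rewrite tE /vsign /vdir /scaled momE /e; ring.
have e0 : e != 0 by apply: contraNneq (t0 0) => e0; rewrite tjE e0 mul0r mulr0.
have W0 j : cross q j != 0 by apply: contraNneq (t0 j) => W0; rewrite tjE W0 !mulr0.
have s0 j : s j != 0 by apply: contraNneq (t0 j) => s0; rewrite tjE s0 mul0r.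
have tinvE j : (t 0 j)^-1 = s j * (e^-1 * (beta j * (cross q j)^-1)).
  have sV : (s j)^-1 = s j.
    by apply: (mulfI (s0 j)); rewrite divff // -expr2 s2.
  by rewrite tjE -{2}sV; field; rewrite s0 e0 beta_neq0 W0.
rewrite /lsign /lam !momE.
set j := i + 1 in cy *; set k := i + 2%:R in cy *.
transitivity (gfun d I q.1 / gfun d I t *
  (t 0 j * q.1 0 k * cross q k * (t 0 k)^-1 - t 0 k * q.1 0 j * cross q j * (t 0 j)^-1)).
  rewrite (cross_cyc _ (cycS cy)) (cross_cyc _ (cycS (cycS cy))).
  by congr (_ * _); field; rewrite !t0.
rewrite !tinvE !tjE.
set gt := (gfun d I t)^-1.
by field; rewrite e0 !beta_neq0 !W0.
Qed.

(** Both sides have equal squares, and continuity keeps the signs constant near [p]. The domain is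
    moreover relatively open in the level set, so the formulas for tilde M hold at nearby points
    too. *)
Lemma tgamma_signed (tgamma : phase R -> vec R) p :
  (forall q, level_set q -> q.2 != 0 -> is_tgamma d I q.1 q.2 (tgamma q)) ->
  {within transformation_domain tgamma, continuous tgamma} ->
  transformation_domain tgamma p ->
  exists s : 'I_3 -> R, (forall i, s i ^+ 2 = 1) /\
    \forall q \near p, level_set q ->
      transformation_domain tgamma q /\ forall i, tgamma q 0 i = vsign s i q.
Proof.
move=> tE tcont pdom; have [lp m0 tp0] := pdom.
have sqE q i : level_set q -> q.2 != 0 -> tgamma q 0 i ^+ 2 = vdir i q ^+ 2.
  move=> lq q0; have [_ _ ->] := is_tgammaP lq q0 (tE _ lq q0).
  by rewrite vdir_sqr.
have v0 i : vdir i p != 0 by rewrite -sqrf_eq0 -sqE // sqrf_eq0.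
exists (fun i => tgamma p 0 i / vdir i p); split => [i|].
  by rewrite exprMn exprVn sqE // divff // sqrf_eq0.
have vnear i : \forall q \near p, 0 < vdir i p * vdir i q.
  have [vd _] := is_gradZ (vdir i p) (is_grad_vdir lp m0 i).
  have := differentiable_continuous vd; move/cvgr_gt; apply.
  by rewrite -expr2 exprn_even_gt0 //= v0.
(* Continuity of [tgamma] is known only within the domain, so this sign information is conditional
   on membership; membership is derived below from [vnear] alone. *)
have tnear i : \forall q \near p, transformation_domain tgamma q ->
      0 < tgamma q 0 i * tgamma p 0 i.
  have tc : tgamma q @[q --> within (transformation_domain tgamma) (nbhs p)] --> tgamma p :=
    (subspace_continuousP _ _).1 tcont p pdom.
  have cc : {for tgamma p, continuous (fun N : vec R => N 0 i * tgamma p 0 i)}.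
    by apply: continuousM; [exact: coord_continuous|exact: cst_continuous].
  have := cvg_comp _ _ tc cc; move/cvgr_gt => /(_ 0).
  rewrite -[X in 0 < X]/(tgamma p 0 i * tgamma p 0 i) -expr2 exprn_even_gt0 //= => /(_ (tp0 i)).
  by rewrite near_withinE.
have all3 (P : 'I_3 -> phase R -> Prop) : (forall i, \forall q \near p, P i q) ->
    \forall q \near p, forall i, P i q.
  move=> h; apply: filterS (filterI (h 0) (filterI (h 1) (h 2%:R))).
  by move=> q [h0 [h1 h2]]; apply: ord3.
apply: filterS2 (all3 _ vnear) (all3 _ tnear) => q vq tq lq.
have q0 : q.2 != 0.
  apply/eqP => q0; have := vq 0.
  by rewrite /vdir /scaled /mom /momentum q0 !mxE !mulr0 subr0 !mulr0 ltxx.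
have vq0 i : vdir i q != 0 by have := vq i; rewrite lt0r mulf_eq0 negb_or => /andP[/andP[]].
have tq0 i : tgamma q 0 i != 0 by rewrite -sqrf_eq0 sqE // sqrf_eq0.
have qdom : transformation_domain tgamma q by [].
split=> // i.
have /eqP := sqE q i lq q0; rewrite eqf_sqr => /orP[] /eqP tqE.
- have /eqP := sqE p i lp m0; rewrite eqf_sqr => /orP[] /eqP tpE.
    by rewrite tqE /vsign tpE divff // mul1r.
  have := tq i qdom; rewrite tqE tpE mulrN oppr_gt0 mulrC => h.
  by have := lt_trans h (vq i); rewrite ltxx.
- have /eqP := sqE p i lp m0; rewrite eqf_sqr => /orP[] /eqP tpE.
    have := tq i qdom; rewrite tqE tpE mulNr oppr_gt0 mulrC => h.
    by have := lt_trans h (vq i); rewrite ltxx.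
  by rewrite tqE /vsign tpE mulNr divff // mulN1r.
Qed.


(** * Integrals of motion *)

Lemma gfun_radicand q : level_set q -> gfun d I q.1 ^+ 2 * \sum_l b l * (q.1 0 l * q.1 0 l) = 1.
Proof.
by case=> xx _; rewrite -radicand_unit // sqr_gfun ?radicand_gt0 // mulVf // gt_eqF // radicand_gt0.
Qed.

(** [lam] is the cross product of the orthogonal vectors [scaled] and [beta gamma], whose squared
    norms are [g^2 wsum] and [g^-2]. *)
Lemma sum_lam_sqr q : level_set q -> \sum_l lam l q ^+ 2 = wsum q.
Proof.
move=> lq; rewrite -[RHS]mul1r -(gfun_radicand lq) /wsum !sum3E /lam !momE /cross !ord3_add -!sqr_beta.
by field; rewrite !beta_neq0.
Qed.

(** The double cross product of [c], [c] and [h = beta gamma] is [c (c, h) - h |c|^2], and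
    [(c, h) = (p, gamma) = 0]. *)
Lemma scaled_cross_lam q i j k : cyc i j k ->
  scaled j q * lam k q - scaled k q * lam j q =
  - (\sum_l scaled l q * scaled l q) * (beta i * q.1 0 i).
Proof.
move=> cy; rewrite (sum_cyc _ cy).
have lE i' j' k' : cyc i' j' k' -> lam i' q =
    scaled j' q * (beta k' * q.1 0 k') - scaled k' q * (beta j' * q.1 0 j').
  by case=> -> ->; rewrite /lam /scaled; ring.
have ch : \sum_l scaled l q * (beta l * q.1 0 l) = 0.
  rewrite sum3E /scaled !momE /cross !ord3_add.
  by field; rewrite !beta_neq0.
move: ch; rewrite (sum_cyc _ cy) => ch.
rewrite (lE _ _ _ (cycS cy)) (lE _ _ _ (cycS (cycS cy))).
apply: subr0_eq.
transitivity (scaled i q * (scaled i q * (beta i * q.1 0 i) + scaled j q * (beta j * q.1 0 j)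
   + scaled k q * (beta k * q.1 0 k))); last by rewrite ch mulr0.
by ring.
Qed.

Section Integrals.
Variables (p : phase R) (s : 'I_3 -> R) (t tM : vec R).
Hypotheses (lp : level_set p) (M_neq0 : p.2 != 0) (s_sqr : forall i, s i ^+ 2 = 1).
Hypotheses (tE : forall i, t 0 i = vsign s i p)
  (tME : forall i, tM 0 i = kap s p * lsign s i p).

Lemma kap_sqr : kap s p ^+ 2 = H2 p.2 / wsum p.
Proof. by rewrite /kap kap_arg_eq // sqr_sqrtr // divr_ge0 // ltW ?H2_gt0 ?wsum_gt0. Qed.

Lemma dot_tgamma_tM : dot t tM = 0.
Proof.
rewrite dot_sum (eq_bigr (fun l => kap s p * (vsign s l p * lsign s l p))) => [|l _].
  by rewrite -mulr_sumr sum_vsign_lsign mulr0.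
by rewrite tE tME mulrCA.
Qed.

Lemma dot_tgamma : dot t t = 1.
Proof.
have S0 := sum_scaled_sqr_gt0 lp M_neq0.
rewrite dot_sum (eq_bigr (fun l => (\sum_l scaled l p * scaled l p)^-1 * (scaled l p * scaled l p))) => [|l _].
  by rewrite -mulr_sumr mulVf // gt_eqF.
by rewrite tE /vsign /vdir -expr2 2!exprMn s_sqr mul1r exprVn sqr_sqrtr ?ltW // expr2.
Qed.

Lemma H2_tM : H2 tM = H2 p.2.
Proof.
have w0 := wsum_gt0 lp M_neq0.
rewrite /H2 dot_sum (eq_bigr (fun l => kap s p ^+ 2 * lam l p ^+ 2)) => [|l _].
  by rewrite -mulr_sumr sum_lam_sqr // kap_sqr divfK // gt_eqF.
by rewrite tME /lsign -expr2 !exprMn !s_sqr !mul1r.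
Qed.

(** Up to signs and a common factor, the cross product of the images is [beta gamma]. When
    [H1_cross] is applied to the image, the weights [1 / b_i] therefore cancel and [|gamma|^2 = 1]
    remains. *)
Lemma cross_tilde_sqr i :
  cross (t, tM) i ^+ 2 = H2 p.2 * gfun d I p.1 ^+ 2 * (b i * (p.1 0 i * p.1 0 i)).
Proof.
have S0 := sum_scaled_sqr_gt0 lp M_neq0; have w0 := wsum_gt0 lp M_neq0.
have cy := cyc_add i; rewrite (cross_cyc _ cy) /= !tE !tME.
set j := i + 1 in cy *; set k := i + 2%:R in cy *.
have lsE i' j' k' : cyc i' j' k' -> lsign s i' p = s j' * s k' * lam i' p by case=> -> ->.
rewrite (lsE _ _ _ (cycS cy)) (lsE _ _ _ (cycS (cycS cy))) /vsign /vdir.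
set S := \sum_l _; set r := (Num.sqrt S)^-1.
transitivity ((kap s p * r) ^+ 2 * s i ^+ 2 *
   (s j ^+ 2 * (scaled j p * lam k p) - s k ^+ 2 * (scaled k p * lam j p)) ^+ 2).
  by ring.
rewrite !s_sqr !mul1r mulr1 (scaled_cross_lam _ cy) -/S exprMn kap_sqr /r exprVn sqr_sqrtr ?ltW //.
rewrite -sqr_beta /S sum_scaled_sqr.
have g0 : gfun d I p.1 != 0 by rewrite gt_eqF // gfun_gt0 // radicand_gt0 //; case: lp.
by field; rewrite g0 gt_eqF.
Qed.

Lemma sqr_gfun_tgamma : gfun d I t ^+ 2 = wsum p / H2 p.2.
Proof. by rewrite -[LHS]invrK -exprVn -(kapE tE) kap_sqr invf_div. Qed.

Lemma gfun_tgamma_H1 : gfun d I t ^+ 2 =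
  1 / gfun d I p.1 ^+ 2 * ((d * H1 d I p.1 p.2 - H2 p.2) /
     ((a 0 * d - 1) * (a 1 * d - 1) * (a 2%:R * d - 1) * H2 p.2)).
Proof.
have g0 : gfun d I p.1 != 0 by rewrite gt_eqF // gfun_gt0 // radicand_gt0 //; case: lp.
rewrite H1_cross // -/(wsum p) sqr_gfun_tgamma.
have aE l : a l * d - 1 = - b l by rewrite /b opprB.
have bn l : b l != 0 by rewrite gt_eqF ?b_gt0.
have m2 : H2 p.2 != 0 by rewrite gt_eqF ?H2_gt0.
by rewrite !aE; field; rewrite ?oppr_eq0 g0 m2 !bn.
Qed.

Lemma H1_tilde : H1 d I p.1 p.2 = H1 d I t tM.
Proof.
have lt : level_set (t, tM) by split; [exact: dot_tgamma|exact: dot_tgamma_tM].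
have m0 := H2_gt0 M_neq0; have w0 := wsum_gt0 lp M_neq0.
(* For [d = 0] the combination [d H1 - H2] carries no information on [H1]. In that case g, [beta]
   and [kap] are 1 and [lam] is [M], so tilde M is [M] up to signs and [H1] is diagonal. Otherwise
   [H1] is recovered from [H1_cross] at both points. *)
have [d0|dn0] := eqVneq d 0.
  have b1 l : b l = 1 by rewrite /b d0 mulr0 subr0.
  have be1 l : beta l = 1 by rewrite /beta b1 sqrtr1.
  have k1 : kap s p = 1 by rewrite /kap d0 mul0r subr0 sqrtr1.
  have g1 : gfun d I p.1 = 1 by rewrite gfunE /radicand d0 mul0r subr0 sqrtr1 invr1.
  have lamE i : lam i p = p.2 0 i.
    rewrite /lam !be1 invr1 !momE g1 !mul1r.
    have cy := cyc_add i; rewrite (cross_cyc _ (cycS cy)) (cross_cyc _ (cycS (cycS cy))).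
    have [xx xm] := lp; rewrite !dot_sum !(sum_cyc _ cy) in xx xm.
    transitivity (p.2 0 i * (p.1 0 i * p.1 0 i + p.1 0 (i + 1) * p.1 0 (i + 1) + p.1 0 (i + 2%:R) * p.1 0 (i + 2%:R))
      - p.1 0 i * (p.1 0 i * p.2 0 i + p.1 0 (i + 1) * p.2 0 (i + 1) + p.1 0 (i + 2%:R) * p.2 0 (i + 2%:R))); first by ring.
    by rewrite xx xm mulr1 mulr0 subr0.
  rewrite !H1E d0 !mul0r !addr0; apply: eq_bigr => l _; congr (_ * _).
  by rewrite tME k1 /lsign lamE mul1r -!expr2 !exprMn !s_sqr !mul1r.
apply: (mulfI dn0); apply: (addIr (- H2 p.2)).
rewrite -{2}H2_tM (H1_cross lt) (H1_cross lp) /= sqr_gfun_tgamma -/(wsum p).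
have -> : \sum_l (b l)^-1 * cross (t, tM) l ^+ 2 = H2 p.2 * gfun d I p.1 ^+ 2.
  rewrite (eq_bigr (fun l => H2 p.2 * gfun d I p.1 ^+ 2 * (p.1 0 l * p.1 0 l))) => [|l _].
    by rewrite -mulr_sumr -dot_sum (proj1 lp) mulr1.
  by rewrite cross_tilde_sqr; field; rewrite gt_eqF ?b_gt0.
by field; rewrite gt_eqF.
Qed.

End Integrals.

End Transformation.



Theorem proposition2 (R : realType) (d : R) (I : 'I_3 -> R)
  (d_ge0 : 0 <= d) (I_gt0 : forall k, 0 < I k)
  (tgamma tM : phase R -> vec R)
  (tgammaE : forall p : phase R, level_set p -> p.2 != 0 ->
     is_tgamma d I p.1 p.2 (tgamma p))
  (tgamma_cont : {within transformation_domain tgamma, continuous tgamma})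
  (tME : forall p : phase R, transformation_domain tgamma p ->
     is_tM d I p.1 p.2 (tgamma p) (tM p))
  (p : phase R) (p_dom : transformation_domain tgamma p) :
  let gamma := p.1 in
  let M := p.2 in
  let a := acoef d I in
  [/\ gfun d I (tgamma p) ^+ 2 =
        1 / gfun d I gamma ^+ 2 *
        ((d * H1 d I gamma M - H2 M) /
         ((a 0 * d - 1) * (a 1 * d - 1) * (a 2%:R * d - 1) * H2 M)),
      forall i j : 'I_3,
        [/\ level_bracket d I (fun q => tM q 0 i) (fun q => tM q 0 j) p
              (brMM d I (tgamma p) (tM p) i j),
            level_bracket d I (fun q => tM q 0 i) (fun q => tgamma q 0 j) p
              (brMg d I (tgamma p) i j) &
            level_bracket d I (fun q => tgamma q 0 i) (fun q => tgamma q 0 j) p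
              0] &
      [/\ dot gamma gamma = dot (tgamma p) (tgamma p),
          dot gamma M = dot (tgamma p) (tM p) /\ dot (tgamma p) (tM p) = 0,
          H1 d I gamma M = H1 d I (tgamma p) (tM p) &
          H2 M = H2 (tM p)]].
Proof.
move=> gamma M a.
have [s [s2 near_p]] := tgamma_signed d_ge0 I_gt0 tgammaE tgamma_cont p_dom.
have [lp M0 t0] := p_dom.
(* The functions [vsign] and [kap * lsign], defined on all of R^6 and differentiable at [p], will
   serve as the local extensions of tilde gamma and tilde M. *)
have agree q : (level_set q -> transformation_domain tgamma q /\
      forall i, tgamma q 0 i = vsign d I s i q) ->
    level_set q -> (forall i, tgamma q 0 i = vsign d I s i q) /\
      forall i, tM q 0 i = kap d I s q * lsign d I s i q.
  move=> h /h [qdom tE]; split => //.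
  by apply: (tM_signed d_ge0 I_gt0 s2 tE) (tME _ qdom); case: qdom.
have [tE tMp] := agree _ (nbhs_singleton near_p) lp.
have near_t i : \forall q \near p, level_set q -> vsign d I s i q = tgamma q 0 i.
  by apply: filterS near_p => q /agree h /h [].
have near_M i : \forall q \near p, level_set q ->
    kap d I s q * lsign d I s i q = tM q 0 i.
  by apply: filterS near_p => q /agree h /h [].
(* The relations of [lie_rel_tM], rewritten as those of the Chaplygin bracket at the image point,
   with [kap] as the inverse of tilde g. *)
have rel : lie_rel (bracket_form d I p) ((tgamma p, tM p).1 0)
    (brK d I (tgamma p, tM p)) (gfun d I (tgamma p, tM p).1)^-1
    (fun i => s i *: dvdir d I p i) (dtM d I p s).
  have kE := kapE tE.
  move=> i j k cy; have := lie_rel_tM d_ge0 I_gt0 lp M0 s2 cy.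
  rewrite /= /brK /= !tE !tMp -kE -[gfun d I _]invrK -kE.
  rewrite [dot _ _](_ : _ = \sum_l acoef d I l * vsign d I s l p *
     (kap d I s p * lsign d I s l p)) //.
  rewrite dot_sum; apply: eq_bigr => l _.
  by rewrite /matA mul_mx_diag !mxE tE tMp; ring.
split.
- exact: (gfun_tgamma_H1 d_ge0 I_gt0 lp M0 s2 tE).
- move=> i j; have [eMM eMg egg] := lie_rel_brMM rel i j.
  have gt l := is_grad_vsign d_ge0 I_gt0 lp M0 s l.
  have gM l := is_grad_tM d_ge0 I_gt0 lp M0 s2 l.
  split.
  + exact: level_bracketI lp (near_M i) (near_M j) (gM i) (gM j) eMM.
  + exact: level_bracketI lp (near_M i) (near_t j) (gM i) (gt j) eMg.
  + exact: level_bracketI lp (near_t i) (near_t j) (gt i) (gt j) egg.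
- have tt := dot_tgamma d_ge0 I_gt0 lp M0 s2 tE.
  have tm := dot_tgamma_tM d_ge0 I_gt0 tE tMp.
  split; [by rewrite tt; case: lp|by rewrite tm; case: lp| |].
  + exact: (H1_tilde d_ge0 I_gt0 lp M0 s2 tE tMp).
  + by rewrite (H2_tM d_ge0 I_gt0 lp M0 s2 tMp).
Qed.
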